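(* Let $\Lambda\subset\mathbb{Z}^d$ be finite and nonempty. For every $0\le a<b<1$, $\mu$ (normalized Lebesgue measure on the set $\mathcal{R}$ of allowed configurations) is the unique invariant probability measure of the CBTW model with parameters $[a,b]$, and starting from every probability measure $\nu$ on $\Omega=[0,1)^\Lambda$, the distribution $\nu_t^{a,b}$ of the process at time $t$ converges exponentially fast in total variation to $\mu$ as $t$ tends to infinity.
   Context: Let $d\ge 1$ and let $\Lambda\subset\mathbb{Z}^d$ be finite and nonempty. Sites $x,y$ are nearest neighbours if $|x-y|=1$ (Euclidean norm). Put $\mathcal{X}=[0,\infty)^\Lambda$ (configurations) and $\Omega=[0,1)^\Lambda$ (stable configurations). Let $\Delta$ be the $|\Lambda|\times|\Lambda|$ matrix with $\Delta(x,x)=1$, $\Delta(x,y)=-\frac1{2d}$ if $|x-y|=1$, and $\Delta(x,y)=0$ otherwise. The toppling operator at $x$ is $T_x\eta=\eta-\Delta(x,\cdot)$; it is legal on $\eta$ if $\eta(x)\ge 1$. It is a known fact that from every $\eta\in\mathcal{X}$, performing legal topplings leads after finitely many steps to a stable configuration, which does not depend on the order of the legal topplings; it is denoted $\mathcal{S}\eta\in\Omega$ (stabilization). With $\delta_x$ the indicator configuration of site $x$, the addition operator is $A_x^u\eta=\mathcal{S}(\eta+u\delta_x)$ for $u\ge 0$. The CBTW sandpile model with parameters $[a,b]\subset[0,1]$ is the Markov chain $\eta_t=A_{X_t}^{U_t}\eta_{t-1}$, $t=1,2,\dots$, on $\Omega$, where $X_1,X_2,\dots$ are i.i.d. uniform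 on $\Lambda$, $U_1,U_2,\dots$ are i.i.d. uniform on $[a,b]$, and the two sequences and the initial configuration $\eta_0$ are independent. For an initial probability measure $\nu$ (the law of $\eta_0$), $\nu_t^{a,b}$ denotes the law of $\eta_t$. For $\eta\in\Omega$ and nonempty $W\subseteq\Lambda$, the restriction $\eta|_W$ is a forbidden sub-configuration (FSC) if for all $x\in W$, $\eta(x)<\frac1{2d}\#\{\text{nearest neighbours of }x\text{ in }W\}$. A configuration $\eta\in\Omega$ is allowed if it has no FSC. $\mathcal{R}$ is the set of allowed configurations, and $\mu$ is the probability measure $\mu(B)=\mathrm{Vol}(B\cap\mathcal{R})/\mathrm{Vol}(\mathcal{R})$, where $\mathrm{Vol}$ is Lebesgue measure. Exponentially fast convergence in total variation means that there are constants $C<\infty$ and $\rho\in(0,1)$ such that the total variation distance between the law at time $t$ and the limit is at most $C\rho^t$ for all $t$. *)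

(* Defs.v *)
From HB Require Import structures.
From mathcomp Require Import all_boot all_order all_algebra finmap.
From mathcomp Require Import all_classical all_reals all_analysis.

Set Implicit Arguments.
Unset Strict Implicit.
Unset Printing Implicit Defensive.

Import Order.TTheory GRing.Theory Num.Theory.
Import numFieldNormedType.Exports.

Local Open Scope classical_set_scope.
Local Open Scope ring_scope.

Section LebesgueTuple.
Context {R : realType}.
Local Open Scope ereal_scope.

Definition cons_pair n (p : measurableTypeR R * n.-tuple R) : n.+1.-tuple R :=
  [tuple of p.1 :: p.2].

Lemma measurable_cons_pair n : measurable_fun setT (@cons_pair n).
Proof. exact: (@measurable_cons _ _ _ R _ n). Qed.

Definition lebesgue_tuple_succ n
    (m : {sigma_finite_measure set (n.-tuple R) -> \bar R}) :
    set (n.+1.-tuple R) -> \bar R :=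
  pushforward (@lebesgue_measure R \x m) (@cons_pair n).

Section Succ.
Variables (n : nat) (m : {sigma_finite_measure set (n.-tuple R) -> \bar R}).

Let succ0 : lebesgue_tuple_succ m set0 = 0.
Proof. by rewrite /lebesgue_tuple_succ /pushforward preimage_set0 measure0. Qed.

Let succ_ge0 A : 0 <= lebesgue_tuple_succ m A.
Proof. by rewrite /lebesgue_tuple_succ /pushforward; exact: measure_ge0. Qed.

Let succ_sigma_additive : semi_sigma_additive (lebesgue_tuple_succ m).
Proof.
move=> F mF tF mUF; rewrite /lebesgue_tuple_succ /pushforward preimage_bigcup.
have mcons B : measurable B -> measurable (@cons_pair n @^-1` B).
  by move=> mB; rewrite -[X in measurable X]setTI; exact: measurable_cons_pair.
apply: measure_semi_sigma_additive => [k||]; first exact: mcons.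
- apply/trivIsetP => /= i j _ _ ij; rewrite -preimage_setI.
  by move/trivIsetP : tF => /(_ _ _ _ _ ij) ->//; rewrite preimage_set0.
- by rewrite -preimage_bigcup; exact: mcons.
Qed.

HB.instance Definition _ := isMeasure.Build _ _ _ (lebesgue_tuple_succ m)
  succ0 succ_ge0 succ_sigma_additive.

Let succ_sigma_finite : sigma_finite setT (lebesgue_tuple_succ m).
Proof.
have [F FT Foo] : sigma_finite setT (@lebesgue_measure R \x m).
  have /sigma_finiteP[F [TF ndF Foo]] := sigma_finiteT (@lebesgue_measure R).
  have /sigma_finiteP[G [TG ndG Goo]] := sigma_finiteT m.
  exists (fun k => F k `*` G k) => [|k].
    rewrite -setXTT TF TG predeqE => -[x y]; split.
      move=> [/= [i _ Fx] [k _ Gy]]; exists (maxn i k) => //; split.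
      - by move: x Fx; exact/subsetPset/ndF/leq_maxl.
      - by move: y Gy; exact/subsetPset/ndG/leq_maxr.
    by move=> [k _ []/= ? ?]; split; exists k.
  have [? ?] := Foo k; have [? ?] := Goo k.
  split; first exact: measurableX.
  by rewrite product_measure1E// lte_mul_pinfty// ge0_fin_numE.
pose g (t : n.+1.-tuple R) : measurableTypeR R * n.-tuple R :=
  (thead t, [tuple of behead t]).
have cK : cancel (@cons_pair n) g.
  by move=> [x t]; congr (_, _); exact/val_inj.
have mg : measurable_fun setT g.
  apply: measurable_fun_pair; first exact: (@measurable_tnth _ R n.+1 ord0).
  exact: measurable_behead.
exists (fun k => g @^-1` F k).
  by rewrite -preimage_bigcup -FT preimage_setT.
move=> k; have [mF Fk] := Foo k; split.
  by rewrite -[X in measurable X]setTI; exact: mg.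
rewrite /lebesgue_tuple_succ /pushforward -comp_preimage.
by rewrite (_ : g \o @cons_pair n = id) //; apply/funext => p /=; rewrite cK.
Qed.

HB.instance Definition _ := Measure_isSigmaFinite.Build _ _ _
  (lebesgue_tuple_succ m) succ_sigma_finite.

End Succ.

Fixpoint lebesgue_tuple n : {sigma_finite_measure set (n.-tuple R) -> \bar R} :=
  match n with
  | 0 => \d_([tuple] : 0.-tuple R)
  | n'.+1 => lebesgue_tuple_succ (lebesgue_tuple n')
  end.

Lemma lebesgue_tuple_box n (D : 'I_n -> set R) :
  (forall i, measurable (D i)) ->
  lebesgue_tuple n [set t | forall i, D i (tnth t i)] =
  \prod_(i < n) lebesgue_measure (D i).
Proof.
elim: n D => [|n IH] D mD /=.
  by rewrite big_ord0 diracE mem_set// => -[].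
rewrite big_ord_recl -IH; last by move=> i; exact: mD.
have mB : measurable
    [set t : n.-tuple R | forall i, D (lift ord0 i) (tnth t i)].
  rewrite (_ : mkset _ = \big[setI/setT]_(i < n)
      ((fun t : n.-tuple R => tnth t i) @^-1` D (lift ord0 i))); last first.
    apply/seteqP; split=> t /=; rewrite -bigcap_seq.
      by move=> Dt i _; exact: Dt.
    by move=> Dt i; apply: Dt => /=; rewrite mem_index_enum.
  apply: bigsetI_measurable => i _; rewrite -[X in measurable X]setTI.
  exact: (@measurable_tnth _ R n i).
rewrite /lebesgue_tuple_succ /pushforward -product_measure1E//; last exact: mD.
congr (_ _); apply/seteqP; split=> -[x t] /=.
  move=> Dt; split; first by have := Dt ord0; rewrite tnth0.
  by move=> i; have := Dt (lift ord0 i); rewrite tnthS.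
move=> [Dx Dt] i; case: (unliftP ord0 i) => [j ->|->].
  by rewrite tnthS.
by rewrite tnth0.
Qed.

End LebesgueTuple.

Section Sandpile.
Context {R : realType} {d : nat} {L : {fset 'rV[int]_d}}.

Definition euclidean_norm (v : 'rV[int]_d) : R :=
  Num.sqrt (\sum_(i < d) (v ord0 i)%:~R ^+ 2).

Definition neighbour (x y : L) : bool :=
  euclidean_norm (fsval x - fsval y) == 1.

Definition Delta (x y : L) : R :=
  if x == y then 1 else if neighbour x y then - (2 * d)%:R^-1 else 0.

(* R^L is represented by tuples, which carry the product sigma-algebra in the
   library; sites index them through their rank in the enumeration of L. *)
Definition conf : Type := #|{: L}|.-tuple R.

Definition height (eta : conf) (x : L) : R := tnth eta (enum_rank x).

Definition mkconf (f : L -> R) : conf :=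
  [tuple f (enum_val i) | i < #|{: L}|].

Lemma height_mkconf f x : height (mkconf f) x = f x.
Proof. by rewrite /height tnth_mktuple enum_rankK. Qed.

Definition stable : set conf := [set eta | forall x, 0 <= height eta x < 1].

Definition topple (x : L) (eta : conf) : conf :=
  mkconf (fun y => height eta y - Delta x y).

Inductive legal_topplings : conf -> conf -> Prop :=
| legal_nil eta : legal_topplings eta eta
| legal_cons x eta xi : 1 <= height eta x ->
    legal_topplings (topple x eta) xi -> legal_topplings eta xi.

(* The default value eta of xget is only met outside [0, +oo[^L, where eta need
   not lead to a stable configuration. *)
Definition stabilize (eta : conf) : conf :=
  xget eta [set xi | legal_topplings eta xi /\ stable xi].

Definition addition (x : L) (u : R) (eta : conf) : conf :=
  stabilize (mkconf (fun y => height eta y + u * (x == y)%:R)).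

Definition forbidden (eta : conf) (W : {set L}) : Prop :=
  W != finset.set0 /\
  forall x, x \in W ->
    height eta x < (2 * d)%:R^-1 * #|[pred y in W | neighbour x y]|%:R.

Definition allowed : set conf :=
  [set eta | stable eta /\ forall W, ~ forbidden eta W].

Definition Vol : {measure set conf -> \bar R} := lebesgue_tuple #|{: L}|.

Definition mu_allowed (B : set conf) : \bar R :=
  (Vol (B `&` allowed) / Vol allowed)%E.

Definition total_variation_dist (p q : set conf -> \bar R) : \bar R :=
  ereal_sup [set `|p B - q B|%E | B in measurable].

Section Model.
Variables (a b : R) (ab : a < b).

(* Transition kernel: the probability that addition x u eta lies in B, for x
   uniform on L and u independent of x and uniform on [a, b]. *)
Definition cbtw_kernel (eta : conf) (B : set conf) : \bar R :=
  (\sum_(x : L) (#|{: L}|%:R^-1)%:E *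
     uniform_prob ab [set u | B (addition x u eta)])%E.

Definition cbtw_invariant (pi : probability conf R) : Prop :=
  forall B, measurable B ->
    (\int[pi]_(eta in stable) cbtw_kernel eta B = pi B)%E.

End Model.
End Sandpile.
Arguments conf R {d} L.
Arguments stable {R d L}.
Arguments allowed {R d L}.

Section Process.
Context {R : realType} {d : nat} {L : {fset 'rV[int]_d}}.
Context {disp : measure_display} {T : measurableType disp}.
Variable P : probability T R.

Definition mutually_independent (I : choiceType) (F : I -> set (set T)) : Prop :=
  forall (J : {fset I}) (E : I -> set T), (forall i, i \in J -> F i (E i)) ->
    (P (\bigcap_(i in [set` J]) E i) = \prod_(i <- J) P (E i))%E.

(* The sigma-algebras generated by the initial configuration eta0, by each
   X t and by each U t; L is discrete. *)
Definition cbtw_sigma (eta0 : T -> conf R L) (X : nat -> T -> L)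
    (U : nat -> T -> R) (i : unit + (nat + nat)) : set (set T) :=
  match i with
  | inl _ => preimage_set_system setT eta0 measurable
  | inr (inl t) => preimage_set_system setT (X t) setT
  | inr (inr t) => preimage_set_system setT (U t) measurable
  end.

(* X t and U t stand for X_(t+1) and U_(t+1): they drive the step from eta t
   to eta t.+1. *)
Record cbtw_process (a b : R) (ab : a < b) (nu : probability (conf R L) R)
    (eta : nat -> T -> conf R L) (X : nat -> T -> L) (U : nat -> T -> R) :
    Prop := {
  cbtw_eta0_meas : measurable_fun setT (eta 0%N);
  cbtw_X_meas : forall t x, measurable (X t @^-1` [set x]);
  cbtw_U_meas : forall t, measurable_fun setT (U t);
  cbtw_eta0_law : forall B, measurable B -> P (eta 0%N @^-1` B) = nu B;
  cbtw_X_law : forall t x, P (X t @^-1` [set x]) = (#|{: L}|%:R^-1)%:E;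
  cbtw_U_law : forall t B, measurable B ->
    P (U t @^-1` B) = uniform_prob ab B;
  cbtw_indep : mutually_independent (cbtw_sigma (eta 0%N) X U);
  cbtw_step : forall t w, eta t.+1 w = addition (X t w) (U t w) (eta t w)
}.

End Process.

(* Main.v *)
Require Import Defs.
From HB Require Import structures.
From mathcomp Require Import all_boot all_order all_algebra finmap.
From mathcomp Require Import all_classical all_reals all_analysis.
From mathcomp Require Import measurable_realfun ring lra.

Set Implicit Arguments.
Unset Strict Implicit.
Unset Printing Implicit Defensive.

Import Order.TTheory GRing.Theory Num.Theory.
Import numFieldNormedType.Exports.

Local Open Scope classical_set_scope.
Local Open Scope ring_scope.

(** Working modulo the lattice spanned by the rows of the toppling matrix, an
    addition is a translation, and every class contains at most one allowed
    configuration: if two of them differ by [m Delta], the set where [m] is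
    maximal is forbidden for one of them. Hence each addition acts on the allowed
    set as an injective piecewise translation and preserves the volume on it,
    which makes [mu] invariant.

    For the convergence, the sum of many independent uniform inputs at each site
    has a density bounded below on a box of large side far from the origin
    (repeated convolution of boxes). Such an addition makes every site topple, so
    the result is allowed, and the box contains a lattice translate of the allowed
    set: some iterate of the kernel dominates a multiple of [mu], uniformly in the
    starting point. This Doeblin condition gives geometric convergence, and
    uniqueness of the invariant law. *)

(** * Topplings, forbidden sub-configurations and the toppling lattice *)

(** The inputs may be confined to an interval much shorter than 1, so one addition per site need not
    reach every lattice class; only sums of many do. The abelian property makes such sums tractable:
    stabilizing after each input or once at the end gives the same configuration, so the state
    reached depends on the inputs only through their total at each site. The density of these totals
    is never computed: a constant lower bound on a box is kept, and the box gives up a margin at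
    each convolution. The size 4 required of the final box has two sources. A lattice point near its
    centre comes from rounding to integers the real solution of [lap f = c], which moves [lap f] by
    at most 1 either way; the difference of two stable heights accounts for another 1 either way.
    All estimates are lower bounds for nonnegative functions, uniform over stable starting points.
    One-sided bounds suffice for total variation, because they apply to an event and to its
    complement alike. *)

Section Lattice.
Context {R : realType} {d : nat} {L : {fset 'rV[int]_d}}.
Hypothesis hd : (0 < d)%N.

Local Notation nbr := (@neighbour R d L).
Local Notation g := ((2 * d)%:R^-1 : R).

(** A sum of integer squares equal to 1 has a single nonzero term. The boolean records the sign,
    [true] standing for -1. *)
Lemma euclidean_norm_eq1 (v : 'rV[int]_d) : euclidean_norm v = 1 :> R ->
  exists p : 'I_d * bool, v = (-1) ^+ p.2 *: delta_mx 0 p.1.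
Proof.
rewrite /euclidean_norm => v1.
have {v1} : \sum_(i < d) (v ord0 i) ^+ 2 = 1 :> int.
  apply: (@intr_inj R); rewrite rmorph_sum /=.
  under eq_bigr do rewrite rmorphXn.
  have s0 : 0 <= \sum_(i < d) ((v ord0 i)%:~R : R) ^+ 2.
    by apply: sumr_ge0 => i _; exact: sqr_ge0.
  by rewrite -[LHS](sqr_sqrtr s0) v1 expr1n.
move=> v1.
have [i vi0] : exists i, v ord0 i != 0.
  apply/existsP; apply: contra_eqT v1; rewrite negb_exists => /forallP v0.
  rewrite big1 // => i _; have /negPn/eqP -> := v0 i; by rewrite expr0n.
have vi1 : 1 <= (v ord0 i) ^+ 2.
  by rewrite -gtz0_ge1 exprn_even_gt0.
move: v1; rewrite (bigD1 i) //= => v1.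
have rest0 : \sum_(j < d | j != i) (v ord0 j) ^+ 2 = 0.
  apply/eqP; rewrite eq_le sumr_ge0 ?andbT; last by move=> j _; exact: sqr_ge0.
  by rewrite -(lerD2l (v ord0 i ^+ 2)) v1 addr0.
have /eqP := v1; rewrite rest0 addr0 sqrf_eq1 => vi.
exists (i, v ord0 i == -1); apply/rowP => j; rewrite !mxE /=.
have [->|ji] := eqVneq j i.
  by case/orP: vi => /eqP ->.
rewrite mulr0; apply/eqP; rewrite -sqrf_eq0; apply/eqP.
by apply: (psumr_eq0P _ rest0) => // k _; exact: sqr_ge0.
Qed.

Lemma neighbour_sym x y : nbr x y = nbr y x.
Proof.
rewrite /neighbour /euclidean_norm; congr (Num.sqrt _ == _).
by apply: eq_bigr => i _; rewrite !mxE -(opprB (fsval x 0 i)) rmorphN sqrrN.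
Qed.

Lemma neighbour_irr x : nbr x x = false.
Proof.
rewrite /neighbour /euclidean_norm subrr big1 ?sqrtr0; last first.
  by move=> i _; rewrite mxE expr0n.
by rewrite eq_sym oner_eq0.
Qed.

Definition deg (W : {set L}) (x : L) : nat := #|[pred y in W | nbr x y]|.

(** Neighbours of [x] inject into the unit steps leading to them. The list [s] is a parameter so as
    to count all [2 * d] steps, or all but one of them at an extremal site. *)
Lemma deg_steps (s : seq ('I_d * bool)) (W : {set L}) (x : L) :
  (forall y (p : 'I_d * bool), y \in W -> fsval x - fsval y = (-1) ^+ p.2 *: delta_mx 0 p.1 ->
    p \in s) ->
  (deg W x <= size s)%N.
Proof.
move=> Ws; rewrite /deg cardE.
pose f (p : 'I_d * bool) := fsval x - (-1) ^+ p.2 *: delta_mx 0 p.1.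
rewrite -(size_map f s).
rewrite -(size_map (@fsval _ L) (enum [pred y in W | nbr x y])).
apply: uniq_leq_size.
  by rewrite map_inj_uniq ?enum_uniq //; exact: val_inj.
move=> _ /mapP[y + ->]; rewrite mem_enum inE => /andP[yW /eqP].
move=> /euclidean_norm_eq1[p xy]; apply/mapP; exists p; first exact: Ws xy.
by rewrite /f -xy opprB addrC subrK.
Qed.

Lemma deg_le (W : {set L}) (x : L) : (deg W x <= 2 * d)%N.
Proof.
have := @deg_steps (enum {: 'I_d * bool}) W x.
rewrite -cardE card_prod card_ord card_bool mulnC; apply.
by move=> *; rewrite mem_enum.
Qed.

(** A site of [W] with maximal first coordinate lacks the neighbour one step further in that
    direction. Through this lemma finiteness of [L] acts as dissipation at the boundary. *)
Lemma exists_deg_lt (W : {set L}) : W != finset.set0 ->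
  exists2 x, x \in W & (deg W x < 2 * d)%N.
Proof.
move=> /finset.set0Pn[x0 x0W]; pose i0 := Ordinal hd.
pose x := [arg max_(x > x0 in W) (fsval x 0 i0)]%O.
have [xW xmax] : x \in W /\ forall y, y \in W -> fsval y 0 i0 <= fsval x 0 i0.
  by rewrite /x; case: Order.TotalTheory.arg_maxP.
exists x => //.
have : (deg W x <= #|predC1 (i0, true)|)%N.
  rewrite cardE; apply: deg_steps => y p yW xy.
  rewrite mem_enum inE; apply: contraTneq (xmax _ yW) => pE.
  move/(congr1 (fun v : 'rV_d => v 0 i0)): xy; rewrite pE !mxE !eqxx /=.
  by move=> h; rewrite -subr_ge0 h.
rewrite cardC1 card_prod card_ord card_bool mulnC => h.
by rewrite (leq_ltn_trans h) // prednK // muln_gt0.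
Qed.

Let g_gt0 : 0 < g.
Proof. by rewrite invr_gt0 ltr0n muln_gt0. Qed.

Let g_deg (W : {set L}) (x : L) : g * (deg W x)%:R <= 1.
Proof.
rewrite mulrC ler_pdivrMr ?mul1r ?ler_nat ?deg_le //.
by rewrite ltr0n muln_gt0.
Qed.

Lemma sum_neighbour_mem (W : {set L}) x :
  \sum_(y | nbr x y) (y \in W)%:R = (deg W x)%:R :> R.
Proof.
rewrite /deg -sum1_card natr_sum big_mkcond [RHS]big_mkcond /=.
by apply: eq_bigr => y _; rewrite inE /= andbC; case: nbr; case: (y \in W).
Qed.

Lemma sum_neighbour_const (c : R) x :
  \sum_(y | nbr x y) c = c * (deg [set: L]%SET x)%:R.
Proof.
rewrite -sum_neighbour_mem mulr_sumr; apply: eq_bigr => y _.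
by rewrite finset.in_setT mulr1.
Qed.

(** The row vector [m] times the toppling matrix: toppling each [x] exactly [m x] times subtracts
    [lap m]. It is a discrete Laplacian with zero boundary values outside [L]. *)
Definition lap (m : L -> R) (y : L) : R := \sum_x m x * Delta x y.

Lemma Delta_sym (x y : L) : Delta x y = Delta y x :> R.
Proof. by rewrite /Delta eq_sym neighbour_sym. Qed.

Lemma lapE m x : lap m x = m x - g * \sum_(y | nbr x y) m y.
Proof.
rewrite /lap (bigD1 x) //= {1}/Delta eqxx mulr1; congr (_ + _).
rewrite big_mkcond /= mulr_sumr [X in - X]big_mkcond /= -sumrN.
apply: eq_bigr => y _; rewrite /Delta neighbour_sym.
have [->|yx] := eqVneq y x; first by rewrite neighbour_irr oppr0.
by case: nbr; rewrite ?mulr0 ?oppr0 // mulrN mulrC.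
Qed.

Lemma lapD m k x : lap (fun y => m y + k y) x = lap m x + lap k x.
Proof. by rewrite /lap -big_split /=; apply: eq_bigr => y _; rewrite mulrDl. Qed.

Lemma lapN m x : lap (fun y => - m y) x = - lap m x.
Proof. by rewrite /lap -sumrN; apply: eq_bigr => y _; rewrite mulNr. Qed.

Lemma lapB m k x : lap (fun y => m y - k y) x = lap m x - lap k x.
Proof. by rewrite lapD lapN. Qed.

Lemma lap_delta x y : lap (fun z => (z == x)%:R) y = Delta x y :> R.
Proof.
rewrite /lap (bigD1 x) //= eqxx mul1r big1 ?addr0 // => z /negbTE ->.
by rewrite mul0r.
Qed.

Lemma lap_le (m : L -> R) (x : L) :
  (forall y, 0 <= m y) -> lap m x <= m x.
Proof.
move=> m0; rewrite lapE gerBl mulr_ge0 ?sumr_ge0 ?ltW //.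
Qed.

(** Together with [lap_le] this controls rounding: an error with values in [0,1] moves [lap] by at
    most 1 either way. *)
Lemma lap_ge (m : L -> R) (x : L) :
  (forall y, 0 <= m y <= 1) -> - 1 <= lap m x.
Proof.
move=> m01; rewrite lapE; have /andP[mx0 _] := m01 x.
have : g * \sum_(y | nbr x y) m y <= g * (deg [set: L]%SET x)%:R.
  rewrite ler_pM2l // -[leRHS]mul1r -sum_neighbour_const.
  by apply: ler_sum => y _; have /andP[] := m01 y.
have := g_deg [set: L]%SET x; lra.
Qed.

(** Maximum principle: were the maximum positive, the set where it is attained would contain all
    [2 * d] neighbours of each of its points, against [exists_deg_lt]. *)
Lemma lap_inj_aux (f : L -> R) : (forall y, lap f y = 0) -> forall x, f x <= 0.
Proof.
move=> f0 x0; rewrite leNgt; apply/negP => fx0.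
pose x1 := [arg max_(x > x0) f x]%O.
have fmax y : f y <= f x1.
  by rewrite /x1; case: Order.TotalTheory.arg_maxP => // i _; exact.
set M := f x1 in fmax.
have M0 : 0 < M by rewrite (lt_le_trans fx0).
have [|x] := @exists_deg_lt [set y | f y == M]%SET.
  by apply/finset.set0Pn; exists x1; rewrite inE.
rewrite inE => /eqP fx; rewrite ltnNge => /negP; apply.
(* The value at [x] is the average over [2 * d] slots, those outside [L] carrying 0. The deficits
   below [M] add up to zero and are nonnegative, so each of them vanishes. *)
have sx : \sum_(y | nbr x y) (M - f y) + ((2 * d)%:R - (deg [set: L]%SET x)%:R) * M = 0.
  have /eqP := f0 x; rewrite lapE subr_eq0 fx => /eqP h.
  have -> : \sum_(y | nbr x y) (M - f y) =
      M * (deg [set: L]%SET x)%:R - (2 * d)%:R * M.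
    rewrite sumrB sum_neighbour_const [in (2 * d)%:R * M]h mulVKf //.
    by rewrite pnatr_eq0 muln_eq0 -lt0n hd.
  ring.
have s0 : 0 <= \sum_(y | nbr x y) (M - f y).
  by apply: sumr_ge0 => y _; rewrite subr_ge0.
have r0 : 0 <= ((2 * d)%:R - (deg [set: L]%SET x)%:R) * M.
  by rewrite mulr_ge0 ?(ltW M0) // subr_ge0 ler_nat deg_le.
have /eqP := sx; rewrite paddr_eq0 // => /andP[/eqP s1].
rewrite mulf_eq0 (gt_eqF M0) orbF subr_eq0 eqr_nat => /eqP ->.
apply/subset_leq_card/fintype.subsetP => y; rewrite !inE => /andP[_ xy].
rewrite xy andbT eq_sym -subr_eq0; apply/eqP.
by apply: (psumr_eq0P _ s1) => // z _; rewrite subr_ge0.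
Qed.

Lemma lap_inj (f : L -> R) : (forall y, lap f y = 0) -> forall x, f x = 0.
Proof.
move=> f0 x; apply/eqP; rewrite eq_le lap_inj_aux //=.
rewrite -oppr_le0 (@lap_inj_aux (fun y => - f y)) // => y.
by rewrite lapN f0 oppr0.
Qed.

Lemma lap_surj (c : L -> R) : exists f : L -> R, forall y, lap f y = c y.
Proof.
pose n := #|{: L}|.
pose D : 'M[R]_n := \matrix_(i, j) Delta (enum_val i) (enum_val j).
pose fn (v : 'rV[R]_n) (x : L) := v 0 (enum_rank x).
have lapM (v : 'rV[R]_n) y : lap (fn v) y = (v *m D) 0 (enum_rank y).
  rewrite mxE /lap (reindex (@enum_val _ {: L})) /=; last first.
    by apply: onW_bij; exact: enum_val_bij.
  by apply: eq_bigr => i _; rewrite /fn mxE enum_valK enum_rankK.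
have uD : D \in unitmx.
  rewrite -row_free_unit; apply/row_freeP; apply/row_freeP.
  rewrite -kermx_eq0; apply/eqP/row_matrixP => i; rewrite row0.
  have : row i (kermx D) *m D = 0 by rewrite -row_mul mulmx_ker row0.
  move: (row i _) => v vD; apply/rowP => j; rewrite !mxE.
  have /lap_inj/(_ (enum_val j)) : forall y, lap (fn v) y = 0.
    by move=> y; rewrite lapM vD mxE.
  by rewrite /fn enum_valK.
exists (fn ((\row_i c (enum_val i)) *m invmx D)) => y.
by rewrite lapM mulmxKV // mxE enum_rankK.
Qed.

(* The Green function of the walk killed outside L, summed over the starting
   point: it exists, is nonnegative, and serves as a potential for topplings. *)
Lemma green_exists : exists h : L -> R,
  (forall y, lap h y = 1) /\ (forall y, 0 <= h y).
Proof.
have [h h1] := lap_surj (fun=> 1); exists h; split=> // x0.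
rewrite leNgt; apply/negP => hx0.
pose x := [arg min_(x < x0) h x]%O.
have hmin y : h x <= h y.
  by rewrite /x; case: Order.TotalTheory.arg_minP => // i _; exact.
have hx : h x < 0 by rewrite (le_lt_trans (hmin x0)).
have := h1 x; rewrite lapE => h1x.
have : h x * (deg [set: L]%SET x)%:R <= \sum_(y | nbr x y) h y.
  by rewrite -sum_neighbour_const; apply: ler_sum => y _.
rewrite -(ler_pM2l g_gt0).
have := g_deg [set: L]%SET x.
rewrite mulrCA.
move: (g * _%:R) (g * _) h1x => p q; nra.
Qed.

(** * Legal topplings, stabilization and forbidden sets *)

Implicit Types (eta xi zeta v w : conf R L) (x y : L).

Lemma conf_ext (eta xi : conf R L) :
  (forall x, height eta x = height xi x) -> eta = xi.
Proof.
move=> h; apply: eq_from_tnth => i.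
by have := h (enum_val i); rewrite /height enum_valK.
Qed.

Definition nonneg (eta : conf R L) := forall x, 0 <= height eta x.
Definition addc (eta v : conf R L) : conf R L :=
  mkconf (fun x => height eta x + height v x).

Lemma height_addc eta v x : height (addc eta v) x = height eta x + height v x.
Proof. by rewrite height_mkconf. Qed.

Lemma height_topple (x : L) (eta : conf R L) y :
  height (topple x eta) y = height eta y - Delta x y.
Proof. by rewrite height_mkconf. Qed.

Lemma addcA eta v w : addc (addc eta v) w = addc eta (addc v w).
Proof. by apply: conf_ext => x; rewrite !height_addc addrA. Qed.

Lemma stable_nonneg eta : stable eta -> nonneg eta.
Proof. by move=> s x; have /andP[] := s x. Qed.

Lemma nonneg_addc eta v : nonneg eta -> nonneg v -> nonneg (addc eta v).
Proof. by move=> e0 v0 x; rewrite height_addc addr_ge0. Qed.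

Lemma topple_ge (x : L) (eta : conf R L) y : y != x -> height eta y <= height (topple x eta) y.
Proof.
move=> yx; rewrite height_topple /Delta eq_sym (negbTE yx).
by case: ifP => _; rewrite ?subr0 // opprK lerDl ltW.
Qed.

Lemma topple_nonneg (x : L) (eta : conf R L) :
  1 <= height eta x -> nonneg eta -> nonneg (topple x eta).
Proof.
move=> ex e0 y; have [->|yx] := eqVneq y x.
  by rewrite height_topple /Delta eqxx subr_ge0.
by rewrite (le_trans (e0 y)) // topple_ge.
Qed.

Lemma legal_trans eta xi zeta : legal_topplings eta xi ->
  legal_topplings xi zeta -> legal_topplings eta zeta.
Proof.
by elim => // x e x' ex _ IH /IH; exact: legal_cons.
Qed.

Lemma legal_addc eta xi v : nonneg v -> legal_topplings eta xi ->
  legal_topplings (addc eta v) (addc xi v).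
Proof.
move=> v0; elim => [e|x e x' ex _ IH]; first exact: legal_nil.
apply: (@legal_cons _ _ _ x).
  by rewrite height_addc (le_trans ex) // lerDl.
rewrite (_ : topple x _ = addc (topple x e) v) //.
apply: conf_ext => y; rewrite !(height_topple, height_addc); ring.
Qed.

(** Least action principle for the odometer [m]: counts [k] that bring all heights below 1, by legal
    topplings or not, must topple any site of height at least 1, since topplings elsewhere only
    raise it. Removing that toppling from both [m] and [k] gives the induction. Two stabilizing
    odometers then bound each other, which yields uniqueness. *)
Lemma legal_odometer eta xi : legal_topplings eta xi ->
  exists m : L -> nat,
    (forall y, height xi y = height eta y - lap (fun x => (m x)%:R) y) /\
    forall k : L -> nat,
      (forall y, height eta y - lap (fun x => (k x)%:R) y < 1) ->
      forall x, (m x <= k x)%N.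
Proof.
elim => [e|x e x' ex _ [m [mE mle]]].
  exists (fun=> 0%N); split=> // y.
  by rewrite /lap big1 ?subr0 // => z _; rewrite mul0r.
exists (fun z => (m z + (z == x))%N); split=> [y|k k1].
  rewrite mE height_topple -lap_delta -addrA -opprD; congr (_ - _).
  rewrite addrC -lapD; congr (lap _ _); apply/funext => z; by rewrite natrD.
have kx : (0 < k x)%N.
  rewrite lt0n; apply/negP => /eqP kx; have := k1 x.
  rewrite lapE kx sub0r opprK ltNge => /negP; apply.
  by rewrite (le_trans ex) // lerDl mulr_ge0 ?(ltW g_gt0) ?sumr_ge0.
have := mle (fun z => (k z - (z == x))%N).
have kle z : ((z == x) <= k z)%N by case: eqP => // ->.
move=> h z; rewrite addnC -leq_subRL //; apply: h => y.
rewrite height_topple -lap_delta -addrA -opprD -lapD.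
rewrite (_ : (fun _ => _) = fun z => (k z)%:R) //.
by apply/funext => w; rewrite -natrD subnKC.
Qed.

Lemma stable_unique eta xi zeta : legal_topplings eta xi -> stable xi ->
  legal_topplings eta zeta -> stable zeta -> xi = zeta.
Proof.
move=> /legal_odometer[m [mE mle]] sx /legal_odometer[k [kE kle]] sz.
apply: conf_ext => y; rewrite mE kE; congr (_ - lap _ _); apply/funext => x.
congr (_%:R); apply/eqP; rewrite eqn_leq mle ?kle // => w.
- by rewrite -mE; have /andP[] := sx w.
- by rewrite -kE; have /andP[] := sz w.
Qed.

Lemma legal_stable_exists eta : nonneg eta ->
  exists2 xi, legal_topplings eta xi & stable xi.
Proof.
have [h [h1 h0]] := green_exists.
(* Toppling [x] lowers this energy by [lap h x = 1], and it stays nonnegative, so it bounds the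
   number of legal topplings. *)
pose E eta := \sum_x height eta x * h x.
have [n] : exists n, E eta < n%:R.
  by exists (Num.truncn (E eta)).+1; exact: truncnS_gt.
elim: n eta => [|n IH] eta En e0.
  have : 0 <= E eta by apply: sumr_ge0 => x _; exact: mulr_ge0.
  by rewrite leNgt En.
have [se|] := pselect (stable eta); first by exists eta => //; exact: legal_nil.
move=> /existsNP[x]; rewrite e0 /= => /negP; rewrite -leNgt => ex.
have [||xi txi sxi] := IH (topple x eta); last by exists xi => //; exact: legal_cons txi.
- rewrite (_ : E _ = E eta - 1); first by rewrite ltrBlDr natr1.
  rewrite /E -(h1 x) /lap -sumrB; apply: eq_bigr => y _.
  by rewrite height_topple mulrBl Delta_sym [Delta _ _ * _]mulrC.
- exact: topple_nonneg.
Qed.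

Lemma stabilize_eq eta xi :
  legal_topplings eta xi -> stable xi -> stabilize eta = xi.
Proof.
move=> lx sx; rewrite /stabilize; case: xgetP => [z _ [lz sz]|h].
  exact: stable_unique lz sz lx sx.
by case: (h xi).
Qed.

Lemma stabilizeP eta : nonneg eta ->
  legal_topplings eta (stabilize eta) /\ stable (stabilize eta).
Proof.
by move=> /legal_stable_exists[xi lx sx]; rewrite (stabilize_eq lx sx).
Qed.

(** Topplings that are legal before [w] is added remain legal afterwards, so the two stabilizations
    concatenate into one legal sequence. *)
Lemma stabilize_addc eta v w : nonneg eta -> nonneg v -> nonneg w ->
  stabilize (addc (stabilize (addc eta v)) w) = stabilize (addc eta (addc v w)).
Proof.
move=> e0 v0 w0.
have [l1 s1] := stabilizeP (nonneg_addc e0 v0).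
have [l2 s2] := stabilizeP (nonneg_addc (stable_nonneg s1) w0).
apply/esym/stabilize_eq => //; apply: legal_trans l2.
by rewrite -addcA; exact: legal_addc.
Qed.

Lemma additionE x (u : R) eta : addition x u eta =
  stabilize (addc eta (mkconf (fun y => u * (x == y)%:R))).
Proof. by congr stabilize; apply: conf_ext => y; rewrite !height_mkconf. Qed.

(** Localized to [D] for an induction along toppling sequences, in which [D] absorbs each toppled
    site. Starting from all of [L] it shows that allowedness persists; starting from the empty set,
    where it is vacuous, that allowedness is created once every site has toppled. *)
Definition no_forbidden_in (D : {set L}) (eta : conf R L) :=
  forall W : {set L}, W \subset D -> ~ forbidden eta W.

Lemma allowedE eta :
  allowed eta <-> stable eta /\ no_forbidden_in [set: L]%SET eta.
Proof.
split=> -[s h]; split=> // W.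
by apply: h; exact: finset.subsetT.
Qed.

Lemma forbidden_mono eta xi (W : {set L}) :
  (forall x, x \in W -> height eta x <= height xi x) ->
  forbidden xi W -> forbidden eta W.
Proof.
by move=> le [W0 h]; split=> // x xW; exact: le_lt_trans (le _ xW) (h _ xW).
Qed.

(** Let [W] be forbidden after the toppling. If [x] is outside [W], heights on [W] were no larger
    before, so [W] was already forbidden. Otherwise [W] without [x] was: dropping [x] costs each
    neighbour of [x] the same amount that the toppling had sent it. *)
Lemma topple_no_forbidden (D : {set L}) x eta :
  1 <= height eta x -> no_forbidden_in D eta ->
  no_forbidden_in (x |: D) (topple x eta).
Proof.
move=> ex nf W WD fW; have [xW|xW] := boolP (x \in W); last first.
  apply: (nf W).
    apply/fintype.subsetP => y yW; have /fintype.subsetP/(_ _ yW) := WD.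
    by rewrite in_setU1 => /predU1P[yx|//]; rewrite -yx yW in xW.
  apply: forbidden_mono fW => y yW; apply: topple_ge.
  by apply: contraNneq xW => <-.
have [W0 fW'] := fW.
apply: (nf (W :\ x)%SET).
  by rewrite finset.subDset -finset.setUC finset.setUC.
have degD y : y != x -> (deg W y)%:R = (deg (W :\ x)%SET y)%:R + (nbr y x)%:R :> R.
  move=> yx; rewrite -!sum_neighbour_mem.
  have [yx'|yx'] := boolP (nbr y x).
    rewrite (bigD1 x) //= [in RHS](bigD1 x) //= xW finset.setD11 add0r addrC.
    by congr (_ + _); apply: eq_bigr => z /andP[_ zx]; rewrite finset.in_setD1 zx.
  rewrite addr0; apply: eq_bigr => z yz; rewrite finset.in_setD1.
  by case: eqP => // zx; rewrite -zx yz in yx'.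
split.
  apply: contraTneq (fW' x xW) => Wx.
  suff -> : #|[pred y in W | nbr x y]| = 0%N.
    by rewrite mulr0 -leNgt height_topple /Delta eqxx subr_ge0.
  apply: eq_card0 => y; rewrite !inE; apply/negbTE; apply/negP => /andP[yW xy].
  have : y \in (W :\ x)%SET.
    rewrite finset.in_setD1 yW andbT; apply: contraTneq xy => ->.
    by rewrite neighbour_irr.
  by rewrite Wx finset.in_set0.
move=> y; rewrite finset.in_setD1 => /andP[yx yW].
have := fW' y yW; rewrite -!/(deg _ _) degD // height_topple.
rewrite /Delta eq_sym (negbTE yx) neighbour_sym.
by case: nbr; rewrite ?subr0 ?addr0 // opprK mulrDr mulr1 ltrD2r.
Qed.

(** The witness is [D] enlarged by the toppled sites; all other sites only receive, hence the
    inequality outside it. *)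
Lemma legal_no_forbidden (D : {set L}) eta xi : legal_topplings eta xi ->
  no_forbidden_in D eta -> exists2 D' : {set L}, D \subset D' &
    no_forbidden_in D' xi /\ forall x, x \notin D' -> height eta x <= height xi x.
Proof.
move=> l; elim: l D => [e|x e x' ex _ IH] D nf; first by exists D.
have [D' DD' [nf' le]] := IH _ (topple_no_forbidden ex nf).
exists D'; first by apply: fintype.subset_trans DD'; exact: finset.subsetUr.
split=> // y yD'; rewrite (le_trans _ (le _ yD')) // topple_ge //.
apply: contraNneq yD' => ->; apply: (fintype.subsetP DD').
by rewrite in_setU1 eqxx.
Qed.

Lemma stabilize_allowed eta : nonneg eta ->
  no_forbidden_in [set: L]%SET eta -> allowed (stabilize eta).
Proof.
move=> e0 nf; have [l s] := stabilizeP e0; apply/allowedE; split=> //.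
have [D' TD [nf' _]] := legal_no_forbidden l nf.
by move=> W _; apply: nf'; rewrite (fintype.subset_trans _ TD) ?finset.subsetT.
Qed.

Lemma allowed_stabilize_addc eta v : nonneg v -> allowed eta ->
  allowed (stabilize (addc eta v)).
Proof.
move=> v0 /allowedE[s nf]; apply: stabilize_allowed.
  by apply: nonneg_addc => //; exact: stable_nonneg.
move=> W WT /(@forbidden_mono eta) fW; apply: (nf W) => //; apply: fW => x _.
by rewrite height_addc lerDl.
Qed.

(** A site that never topples would keep a height of at least 1 and contradict stability. So every
    site topples, and the set grown from the empty one is all of [L]. *)
Lemma stabilize_ge1_allowed eta :
  (forall x, 1 <= height eta x) -> allowed (stabilize eta).
Proof.
move=> e1; have e0 : nonneg eta by move=> x; exact: le_trans (e1 x).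
have [l s] := stabilizeP e0; apply/allowedE; split=> //.
have [|D' _ [nf le]] := @legal_no_forbidden finset.set0 _ _ l.
  by move=> W; rewrite finset.subset0 => /eqP -> []; rewrite eqxx.
move=> W _; apply: nf; apply/fintype.subsetP => x _; apply: contraT => xD.
have /andP[_] := s x.
by rewrite ltNge (le_trans (e1 x)) // le.
Qed.

(* The set W where the odometer difference k is maximal is forbidden for xi. *)
Lemma allowed_unique_le (eta xi : conf R L) (k : L -> int) :
  stable eta -> allowed xi ->
  (forall y, height eta y = height xi y + lap (fun x => (k x)%:~R) y) ->
  forall x, k x <= 0.
Proof.
move=> se ax eE x0; rewrite leNgt; apply/negP => kx0.
pose x1 := [arg max_(x > x0) k x]%O.
have kmax y : k y <= k x1.
  by rewrite /x1; case: Order.TotalTheory.arg_maxP => // i _; exact.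
set M := k x1 in kmax.
have M1 : 1 <= M by rewrite -gtz0_ge1 (lt_le_trans kx0).
case: ax => _ /(_ [set y | k y == M]%SET); apply; split.
  by apply/finset.set0Pn; exists x1; rewrite inE.
move=> x; rewrite inE => /eqP kx; rewrite -/(deg _ _).
set W := [set y | _]%SET.
have /andP[_] := se x; rewrite eE lapE kx.
(* Integrality enters here: a neighbour outside [W] has [k] at most [M - 1]. Since [g] times the
   degree is at most 1 and [M] at least 1, the layers below the top one only help, and the bound
   left at [x] is that of a forbidden set. *)
have : \sum_(y | nbr x y) ((k y)%:~R : R) <=
    (M%:~R - 1) * (deg [set: L]%SET x)%:R + (deg W x)%:R.
  rewrite -sum_neighbour_const -sum_neighbour_mem -big_split /=.
  apply: ler_sum => y _; rewrite inE; have [->|kM] := eqVneq (k y) M.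
    by rewrite subrK.
  rewrite addr0 -(intrB _ _ 1) ler_int -ltzD1 subrK lt_neqAle kM //=.
rewrite -(ler_pM2l g_gt0) mulrDr.
have := g_deg [set: L]%SET x; rewrite mulrCA.
have : 1 <= M%:~R :> R by rewrite ler1z.
nra.
Qed.

Lemma allowed_unique (eta xi : conf R L) (k : L -> int) :
  allowed eta -> allowed xi ->
  (forall y, height eta y = height xi y + lap (fun x => (k x)%:~R) y) ->
  eta = xi.
Proof.
move=> ae ax eE; have k0 x : k x = 0.
  apply/eqP; have se : stable eta by case: ae.
  rewrite eq_le (allowed_unique_le se ax eE) /=.
  rewrite -oppr_le0.
  apply: (@allowed_unique_le xi eta (fun x => - k x)) => //; first by case: ax.
  move=> y; rewrite eE -addrA -lapD /lap big1 ?addr0 // => z _.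
  by rewrite -intrD subrr mul0r.
apply: conf_ext => y; rewrite eE /lap big1 ?addr0 // => z _.
by rewrite k0 mul0r.
Qed.

Lemma stabilize_lap eta : nonneg eta -> exists m : L -> nat,
  forall y, height (stabilize eta) y = height eta y - lap (fun x => (m x)%:R) y.
Proof.
by move=> /stabilizeP[/legal_odometer[m [mE _]] _]; exists m.
Qed.

End Lattice.

(** * Measurability and volume *)

Section TranslationInvariance.
Context {R : realType}.

Lemma lebesgue_measure_shift (c : R) (A : set R) : measurable A ->
  lebesgue_measure ((fun x => x + c) @^-1` A) = lebesgue_measure A.
Proof.
move=> mA; have mc : measurable_fun setT (fun x : R => x + c : measurableTypeR R).
  exact: measurable_funD.
rewrite -[LHS]/(pushforward lebesgue_measure
  (fun x : R => x + c : measurableTypeR R) A).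
apply/esym/lebesgue_measure_unique => //= _ [[a b]] _ <-.
rewrite /pushforward (_ : _ @^-1` _ = `]a - c, b - c]%classic).
  rewrite !lebesgue_measure_itv/= !lte_fin ltrD2r; case: ifPn => // _.
  by rewrite -!EFinB opprB addrA subrK.
by apply/seteqP; split => x /=; rewrite !in_itv /= ltrBlDr lerBrDr.
Qed.

Definition tuple_add n (v t : n.-tuple R) : n.-tuple R :=
  [tuple tnth t i + tnth v i | i < n].

Lemma measurable_tuple_add n (v : n.-tuple R) :
  measurable_fun setT (tuple_add v).
Proof.
apply/measurable_fun_tnthP => i.
rewrite (_ : _ \o _ = fun t => tnth t i + tnth v i); last first.
  by apply/funext => t /=; rewrite tnth_mktuple.
by apply: measurable_funD => //; exact: measurable_tnth.
Qed.

Lemma lebesgue_tuple_shift n (v : n.-tuple R) (A : set (n.-tuple R)) :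
  measurable A -> lebesgue_tuple n (tuple_add v @^-1` A) = lebesgue_tuple n A.
Proof.
elim: n v A => [|n IH] v A mA /=.
  rewrite (_ : _ @^-1` _ = A) //; apply/seteqP; split => t /=;
    by rewrite (tuple0 (tuple_add _ _)) (tuple0 t).
rewrite /lebesgue_tuple_succ /pushforward.
pose w := [tuple of behead v].
pose phi (p : measurableTypeR R * n.-tuple R) : measurableTypeR R * n.-tuple R :=
  (p.1 + thead v, tuple_add w p.2).
have mphi : measurable_fun setT phi.
  apply: measurable_fun_pair.
    by apply: measurable_funD => //; exact: measurable_fst.
  by apply: measurableT_comp => //; exact: measurable_tuple_add.
have addE : tuple_add v \o @cons_pair R n = @cons_pair R n \o phi.
  apply/funext => -[x t].
  apply: eq_from_tnth => i; rewrite tnth_mktuple /cons_pair /=.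
  case: (unliftP ord0 i) => [j ->|->]; last by rewrite !tnth0.
  rewrite !tnthS tnth_mktuple; congr (_ + _).
  rewrite tnth_behead; congr tnth; apply/val_inj.
  by rewrite /= inordK // ltnS.
rewrite -[_ @^-1` (tuple_add v @^-1` A)]/((tuple_add v \o @cons_pair R n) @^-1` A).
rewrite addE -[_ @^-1` A]/(phi @^-1` (@cons_pair R n @^-1` A)).
have mB : measurable (@cons_pair R n @^-1` A).
  by rewrite -[X in measurable X]setTI; exact: measurable_cons_pair.
move: (_ @^-1` A) mB => B mB.
rewrite -[LHS]/(pushforward (@lebesgue_measure R \x lebesgue_tuple n)%E phi B).
apply/esym/product_measure_unique => //= C D mC mD.
have mC' : measurable ((fun x : measurableTypeR R => x + thead v : measurableTypeR R) @^-1` C).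
  rewrite -[X in measurable X]setTI.
  by apply: (_ : measurable_fun setT _) => //; exact: measurable_funD.
have mD' : measurable (tuple_add w @^-1` D).
  by rewrite -[X in measurable X]setTI; exact: measurable_tuple_add.
have := product_measure1E (@lebesgue_measure R) (lebesgue_tuple n) mC' mD'.
move=> h; apply: etrans h _.
by congr (_ * _)%E; [exact: lebesgue_measure_shift|exact: IH].
Qed.

End TranslationInvariance.

(** * Measurability of stabilization and additions *)

Section Measurability.
Context {R : realType} {d : nat} {L : {fset 'rV[int]_d}}.
Hypothesis hd : (0 < d)%N.
Implicit Types (eta xi zeta v w : conf R L) (x y : L).

Lemma countable_bigcup_measurable d' (T : measurableType d') (I : countType)
  (F : I -> set T) : (forall i, measurable (F i)) -> measurable (\bigcup_i F i).
Proof. by move=> mF; apply: countable_bigcupT_measurable. Qed.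

Lemma finite_forall_measurable d' (T : measurableType d') (I : finType)
  (F : I -> set T) : (forall i, measurable (F i)) ->
  measurable [set t | forall i, F i t].
Proof.
move=> mF; rewrite (_ : mkset _ = \big[setI/setT]_(i : I) F i).
  exact: bigsetI_measurable.
apply/seteqP; split=> t /=; rewrite -bigcap_seq.
  by move=> Ft i _; exact: Ft.
by move=> Ft i; apply: Ft => /=; rewrite mem_index_enum.
Qed.

Lemma measurable_height x : measurable_fun setT (fun eta => height eta x).
Proof. exact: (@measurable_tnth _ R). Qed.

Lemma measurable_confP d' (T : measurableType d') (f : T -> conf R L) :
  measurable_fun setT f <->
  forall x, measurable_fun setT (fun t => height (f t) x).
Proof.
split=> [mf x|mf].
  exact: (measurableT_comp (measurable_height x)).
apply/measurable_fun_tnthP => i.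
by have := mf (enum_val i); rewrite /height enum_valK.
Qed.

Lemma measurable_set_le d' (T : measurableType d') (f h : T -> R) :
  measurable_fun setT f -> measurable_fun setT h ->
  measurable [set t | f t <= h t].
Proof.
by move=> mf mh; have := measurable_fun_le measurableT mf mh; rewrite setTI.
Qed.

Lemma measurable_set_lt d' (T : measurableType d') (f h : T -> R) :
  measurable_fun setT f -> measurable_fun setT h ->
  measurable [set t | f t < h t].
Proof.
move=> mf mh.
rewrite (_ : mkset _ = ~` [set t | h t <= f t]).
  by apply: measurableC; exact: measurable_set_le.
by apply/seteqP; split=> t /=; rewrite ltNge => /negP.
Qed.

Lemma measurable_topple x : measurable_fun setT (topple x : conf R L -> conf R L).
Proof.
apply/measurable_confP => y; under eq_fun do rewrite height_mkconf.
by apply: measurable_funB => //; exact: measurable_height.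
Qed.

Lemma measurable_stable : measurable (@stable R d L).
Proof.
apply: finite_forall_measurable => x.
rewrite [X in measurable X](_ : _ = [set eta | 0 <= height eta x] `&` [set eta | height eta x < 1]).
  apply: measurableI; [apply: measurable_set_le|apply: measurable_set_lt] => //;
    exact: measurable_height.
by apply/seteqP; split=> eta /= => [/andP[]//|[-> ->]].
Qed.

Lemma measurable_allowed : measurable (@allowed R d L).
Proof.
rewrite (_ : allowed = stable `&` [set eta | forall W, (~` forbidden ^~ W) eta]) //.
apply: measurableI; first exact: measurable_stable.
apply: finite_forall_measurable => W; apply: measurableC.
have [W0|W0] := boolP (W != finset.set0); last first.
  rewrite (_ : forbidden ^~ W = set0) //; apply/seteqP; split=> // eta [].
  by rewrite (negbTE W0).
rewrite (_ : forbidden ^~ W = [set eta | forall x, [set eta | x \in W ->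
    height eta x < (2 * d)%:R^-1 * #|[pred y in W | @neighbour R d L x y]|%:R] eta]).
  apply: finite_forall_measurable => x; have [xW|xW] := boolP (x \in W).
    rewrite (_ : mkset _ = [set eta | height eta x <
       (2 * d)%:R^-1 * #|[pred y in W | @neighbour R d L x y]|%:R]).
      by apply: measurable_set_lt => //; exact: measurable_height.
    by apply/seteqP; split=> eta /=; [exact|move=> h _].
  by rewrite [X in measurable X](_ : _ = setT) //; apply/seteqP; split.
by apply/seteqP; split=> eta /= => [[]|] //.
Qed.

(** Toppling sequences as lists: there are countably many, so [stabilize] becomes a countable gluing
    of measurable maps. *)
Definition toppled (s : seq L) eta : conf R L :=
  foldl (fun e x => topple x e) eta s.

Fixpoint legal_seq (s : seq L) : set (conf R L) :=
  if s is x :: s' then [set eta | 1 <= height eta x] `&` (topple x @^-1` legal_seq s')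
  else setT.

Lemma legal_seqP eta xi : legal_topplings eta xi <->
  exists2 s, legal_seq s eta & xi = toppled s eta.
Proof.
split=> [|[s + ->]].
  elim=> [e|x e x' ex _ [s ls ->]]; first by exists [::].
  by exists (x :: s).
elim: s eta => [|x s IH] eta /=; first by move=> _; exact: legal_nil.
by move=> [ex /IH]; exact: legal_cons.
Qed.

Lemma measurable_preimageT d1 d2 (T1 : measurableType d1) (T2 : measurableType d2)
  (f : T1 -> T2) (B : set T2) :
  measurable_fun setT f -> measurable B -> measurable (f @^-1` B).
Proof. by move=> mf mB; rewrite -[X in measurable X]setTI; exact: mf. Qed.

Lemma measurable_toppled s : measurable_fun setT (toppled s).
Proof.
elim: s => [|x s IH]; first exact: measurable_id.
rewrite (_ : toppled _ = toppled s \o topple x) //.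
by apply: measurableT_comp => //; exact: measurable_topple.
Qed.

Lemma measurable_legal_seq s : measurable (legal_seq s).
Proof.
elim: s => [|x s IH] /=; first exact: measurableT.
apply: measurableI; last exact: measurable_preimageT (measurable_topple x) IH.
by apply: measurable_set_le => //; exact: measurable_height.
Qed.

Let stabilized_by s := legal_seq s `&` (toppled s @^-1` @stable R d L).

Let measurable_stabilized_by s : measurable (stabilized_by s).
Proof.
apply: measurableI; first exact: measurable_legal_seq.
exact: measurable_preimageT (measurable_toppled s) measurable_stable.
Qed.

(* Outside the union of the stabilized_by sets, stabilize is the identity. *)
Lemma measurable_stabilize : measurable_fun setT (@stabilize R d L).
Proof.
move=> _ B mB; rewrite setTI.
rewrite (_ : _ @^-1` B = (\bigcup_s (stabilized_by s `&` (toppled s @^-1` B)))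
   `|` (~` (\bigcup_s stabilized_by s) `&` B)).
  apply: measurableU; last first.
    apply: measurableI => //; apply: measurableC.
    exact: countable_bigcup_measurable.
  apply: countable_bigcup_measurable => s; apply: measurableI => //.
  exact: measurable_preimageT (measurable_toppled s) mB.
have stE eta s : stabilized_by s eta -> stabilize eta = toppled s eta.
  by case=> ls ss; apply: (stabilize_eq hd) => //; apply/legal_seqP; exists s.
apply/seteqP; split=> eta /=; last first.
  move=> [[s _ [/stE]]|[ns]]; first by move=> ->.
  rewrite /stabilize; case: xgetP => // xi _ [/legal_seqP[s ls ->] ss].
  by exfalso; apply: ns; exists s.
have [[s _ ss]|ns] := pselect ((\bigcup_s stabilized_by s) eta).
  by rewrite (stE _ _ ss) => Bs; left; exists s.
rewrite /stabilize; case: xgetP => [xi _ [/legal_seqP[s ls ->] ss]|_ Be].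
  by exfalso; apply: ns; exists s.
by right.
Qed.

Lemma measurable_mkconf d' (T : measurableType d') (f : T -> L -> R) :
  (forall x, measurable_fun setT (f ^~ x)) ->
  measurable_fun setT (fun t => mkconf (f t) : conf R L).
Proof.
by move=> mf; apply/measurable_confP => x; under eq_fun do rewrite height_mkconf; exact: mf.
Qed.

Lemma measurable_addc2 : measurable_fun setT
  (fun p : conf R L * conf R L => addc p.1 p.2).
Proof.
apply: measurable_mkconf => x; apply: measurable_funD.
  by apply: (measurableT_comp (measurable_height x)).
by apply: (measurableT_comp (measurable_height x)).
Qed.

Lemma measurable_addition x : measurable_fun setT
  (fun p : measurableTypeR R * conf R L => addition x p.1 p.2).
Proof.
apply: (measurableT_comp measurable_stabilize).
apply: measurable_mkconf => y; apply: measurable_funD.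
  by apply: (measurableT_comp (measurable_height y)).
by apply: measurable_funM => //; exact: measurable_fst.
Qed.

End Measurability.

(** * Volume of the allowed set, and its preservation by additions *)

Section Volume.
Context {R : realType} {d : nat} {L : {fset 'rV[int]_d}}.
Hypothesis hd : (0 < d)%N.
Implicit Types (eta xi zeta v w : conf R L) (x y : L).
Local Notation Vol := (@Vol R d L).

Lemma Vol_shift v (A : set (conf R L)) : measurable A ->
  Vol ((addc ^~ v) @^-1` A) = Vol A.
Proof.
move=> mA; rewrite (_ : addc ^~ v = tuple_add v).
  exact: lebesgue_tuple_shift.
apply/funext => eta; apply: conf_ext => x.
by rewrite height_addc /height tnth_mktuple.
Qed.

Lemma Vol_box (D : L -> set R) : (forall x, measurable (D x)) ->
  Vol [set eta | forall x, D x (height eta x)] =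
  (\prod_(x : L) lebesgue_measure (D x))%E.
Proof.
move=> mD; rewrite (reindex (@enum_val _ {: L})) /=; last first.
  by apply: onW_bij; exact: enum_val_bij.
rewrite -(lebesgue_tuple_box (D := fun i => D (enum_val i))) //.
congr (lebesgue_tuple _ _); apply/seteqP; split=> eta /= h i.
  by have := h (enum_val i); rewrite /height enum_valK.
by have := h (enum_rank i); rewrite enum_rankK.
Qed.

Lemma Vol_stable : Vol stable = 1%E.
Proof.
rewrite (_ : stable = [set eta | forall x, `[0, 1[%classic (height eta x)]); last first.
  by apply/seteqP; split=> eta /= h x; have := h x; rewrite /= in_itv.
rewrite (@Vol_box (fun=> `[0, 1[%classic)) // big1 // => x _.
rewrite lebesgue_measure_itv /= lte_fin ltr01.
by rewrite sube0.
Qed.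

Lemma Vol_allowed_le1 : (Vol allowed <= 1)%E.
Proof.
rewrite -Vol_stable le_measure ?inE //.
- exact: measurable_allowed.
- exact: measurable_stable.
- by move=> eta [].
Qed.

Lemma Vol_allowed_gt0 : (0 < Vol allowed)%E.
Proof.
set g : R := (2 * d)%:R^-1.
have g0 : 0 < g by rewrite invr_gt0 ltr0n muln_gt0.
(* Every [W] has a site with at most [2 * d - 1] neighbours in [W], and [1 - g] is exactly the
   height that prevents [W] from being forbidden there. So this box is allowed, with volume [g] to
   the power of the number of sites. *)
pose D (x : L) : set R := `[1 - g, 1[%classic.
have g1 : g <= 1 by rewrite invf_le1 ?ltr0n ?muln_gt0 // ler1n muln_gt0.
have : (Vol [set eta | forall x, D x (height eta x)] <= Vol allowed)%E.
  apply: le_measure; rewrite ?inE; last 2 first.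
  - exact: measurable_allowed.
  - move=> eta De; split=> [x|W [W0 fW]].
      have := De x; rewrite /D /= in_itv /= => /andP[h ->]; rewrite andbT.
      by rewrite (le_trans _ h) // subr_ge0.
    have [x xW dx] := @exists_deg_lt R _ _ hd _ W0.
    have := fW x xW; rewrite ltNge => /negP; apply.
    have := De x; rewrite /D /= in_itv /= => /andP[h _]; rewrite (le_trans _ h) //.
    rewrite -/(deg _ _) -/g mulrC ler_pdivrMr ?ltr0n ?muln_gt0 //.
    rewrite mulrBl mul1r mulVf ?pnatr_eq0 -?lt0n ?muln_gt0 //.
    by rewrite lerBrDr natr1 ler_nat.
  apply: finite_forall_measurable => x.
  by apply: (measurable_preimageT (measurable_height x)); exact: measurable_itv.
apply: lt_le_trans; rewrite Vol_box //; last by move=> x; exact: measurable_itv.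
elim/big_ind: _ => //= [p q p0 q0|x _]; first exact: mule_gt0.
rewrite lebesgue_measure_itv /= lte_fin gtrBl g0 -EFinB lte_fin opprB.
by rewrite addrC subrK.
Qed.

(** Cut the domain according to the odometer [m]. On each piece [D' m] the addition is a
    translation, its image is the corresponding piece of [E], and these images are disjoint subsets
    of [allowed] and [B]. *)
Lemma Vol_allowed_addition_le x (u : R) (B : set (conf R L)) : 0 <= u ->
  measurable B ->
  (Vol (allowed `&` (addition x u @^-1` B)) <= Vol (allowed `&` B))%E.
Proof.
move=> u0 mB; set A := addition x u.
pose dx := mkconf (fun y => u * (x == y)%:R) : conf R L.
have dx0 : nonneg dx by move=> y; rewrite height_mkconf mulr_ge0.
have AE eta : A eta = stabilize (addc eta dx) by exact: additionE.
have mA : measurable_fun setT A.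
  exact: (measurableT_comp (measurable_addition hd x) (pair1_measurable (u : measurableTypeR R))).
pose sh (m : {ffun L -> nat}) : conf R L :=
  mkconf (fun y => lap (fun z => (m z)%:R) y - height dx y).
pose D' (m : {ffun L -> nat}) := [set eta | allowed eta /\ B (A eta) /\ eta = addc (A eta) (sh m)].
(* Pieces are indexed by codes of odometers, to apply countable additivity; a number that codes no
   odometer gives the empty piece. *)
pose D (i : nat) : set (conf R L) := if @pickle_inv {ffun L -> nat} i is Some m then D' m else set0.
pose E (i : nat) : set (conf R L) := if @pickle_inv {ffun L -> nat} i is Some m then
   (addc ^~ (sh m)) @^-1` D' m else set0.
have madd m : measurable_fun setT ((addc ^~ (sh m)) : conf R L -> conf R L).
  apply: measurable_mkconf => y; apply: measurable_funD => //.
  exact: measurable_height.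
have mD' m : measurable (D' m).
  rewrite (_ : D' m = (allowed `&` (A @^-1` B)) `&` [set eta | forall y,
    [set eta | height eta y == height (addc (A eta) (sh m)) y] eta]).
    apply: measurableI; first apply: measurableI.
    - exact: measurable_allowed.
    - exact: measurable_preimageT.
    apply: finite_forall_measurable => y.
    rewrite -[X in measurable X]setTI.
    apply: (@measurable_fun_eqr _ _ _ setT _ _ _ _ measurableT [set true]) => //.
      exact: measurable_height.
    by apply: (measurableT_comp (measurable_height y)); apply: (measurableT_comp (madd m)).
  apply/seteqP; split=> eta /=.
    by move=> [ae [Be eE]]; split=> // y; rewrite -eE.
  by move=> [[ae Be] eE]; split=> //; split=> //; apply: conf_ext => y; exact/eqP.
have mD i : measurable (D i) by rewrite /D; case: pickle_inv.
have mE i : measurable (E i).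
  by rewrite /E; case: pickle_inv => // m; exact: measurable_preimageT.
have shI m m' : sh m = sh m' -> m = m'.
  move=> smm; apply/ffunP => y; apply/eqP; rewrite -(eqr_nat R) -subr_eq0; apply/eqP.
  apply: (@lap_inj R d L hd (fun z => (m z)%:R - (m' z)%:R)) => z; rewrite lapB.
  have := congr1 (height ^~ z) smm; rewrite !height_mkconf => /addIr ->.
  by rewrite subrr.
have addcI xi v w : addc xi v = addc xi w -> v = w.
  move=> h; apply: conf_ext => y; have := congr1 (height ^~ y) h.
  by rewrite !height_addc => /addrI.
have pinv i j m : @pickle_inv {ffun L -> nat} i = Some m -> pickle_inv j = Some m -> i = j.
  move=> hi hj; have := @pickle_invK {ffun L -> nat} i; rewrite hi /= => <-.
  by have := @pickle_invK {ffun L -> nat} j; rewrite hj.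
have tD : trivIset setT D.
  apply/trivIsetP => i j _ _ ij; apply/seteqP; split=> // eta [].
  rewrite /D; case Ei: pickle_inv => [m|//]; case Ej: pickle_inv => [m'|//].
  move=> [_ [_ e1]] [_ [_ e2]]; move: ij; rewrite (pinv i j m) ?eqxx //.
  by rewrite Ej; congr Some; apply/esym/shI/(@addcI (A eta)); rewrite -e1 -e2.
have E_eq z m : ((addc ^~ (sh m)) @^-1` D' m) z -> A (addc z (sh m)) = z.
  move=> [_ [_ e]]; apply: conf_ext => y; have := congr1 (height ^~ y) e.
  by rewrite !height_addc => /addIr.
(* Two allowed preimages of the same [z] differ by an integer combination of rows, hence coincide,
   and then so do their shifts and their odometers. *)
have tE : trivIset setT E.
  apply/trivIsetP => i j _ _ ij; apply/seteqP; split=> // z [].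
  rewrite /E; case Ei: pickle_inv => [m|//]; case Ej: pickle_inv => [m'|//].
  move=> [a1 _] [a2 _]; move: ij; rewrite (pinv i j m) ?eqxx //.
  rewrite Ej; congr Some; apply/esym/shI/(@addcI z).
  apply: (@allowed_unique _ _ _ hd _ _ (fun x => (m x)%:Z - (m' x)%:Z)) => // y.
  rewrite !height_addc !height_mkconf.
  have -> : (fun x => ((m x)%:Z - (m' x)%:Z)%:~R : R) =
      fun x => (m x)%:R - (m' x)%:R.
    by apply/funext => w; rewrite intrB.
  rewrite lapB; ring.
have -> : allowed `&` (A @^-1` B) = \bigcup_i D i.
  apply/seteqP; split=> eta /=.
    move=> [ae Be]; have e0 : nonneg eta by apply: stable_nonneg; case: ae.
    have [m mE'] := stabilize_lap hd (nonneg_addc e0 dx0).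
    exists (@choice.pickle {ffun L -> nat} [ffun x => m x]) => //.
    rewrite /D pickleK_inv; split=> //.
    split=> //; apply: conf_ext => y; rewrite height_addc height_mkconf AE mE'.
    rewrite height_addc (_ : (fun z => ([ffun x => m x] z)%:R) = fun x => (m x)%:R).
      ring.
    by apply/funext => z; rewrite ffunE.
  move=> [i _]; rewrite /D; case: pickle_inv => // m [ae [Be _]]; split=> //.
rewrite measure_bigcup //.
have VDE i : Vol (D i) = Vol (E i).
  by rewrite /D /E; case: pickle_inv => // m; rewrite Vol_shift.
under eq_eseriesr do rewrite VDE.
rewrite -measure_bigcup //; apply: le_measure; rewrite ?inE.
- by apply: bigcup_measurable => i _.
- by apply: measurableI => //; exact: measurable_allowed.
move=> z [i _]; rewrite /E; case: pickle_inv => // m Dz.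
have Az := E_eq _ _ Dz; have [ae [Be _]] := Dz; rewrite -Az; split=> //.
by rewrite AE; exact: allowed_stabilize_addc.
Qed.

Lemma fin_add_le_cancel (p q r s : \bar R) :
  p \is a fin_num -> q \is a fin_num -> r \is a fin_num -> s \is a fin_num ->
  (p + q = r + s -> q <= s -> r <= p)%E.
Proof.
move: p q r s => [p| |] [q| |] [r| |] [s| |] // _ _ _ _.
rewrite -!EFinD => /eqP; rewrite eqe !lee_fin => /eqP h qs; lra.
Qed.

(** The inequality also holds for the complement of [B]. Both pairs of volumes add up to the same
    finite total, so neither inequality can be strict. *)
Lemma Vol_allowed_addition x (u : R) (B : set (conf R L)) : 0 <= u ->
  measurable B ->
  Vol (allowed `&` (addition x u @^-1` B)) = Vol (allowed `&` B).
Proof.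
move=> u0 mB; set A := addition x u.
have mA : measurable_fun setT A.
  exact: (measurableT_comp (measurable_addition hd x) (pair1_measurable (u : measurableTypeR R))).
have split_allowed (C : set (conf R L)) : measurable C ->
    Vol (allowed `&` C) \is a fin_num /\
    (Vol (allowed `&` C) + Vol (allowed `&` ~` C) = Vol allowed)%E.
  move=> mC; split.
    rewrite ge0_fin_numE ?measure_ge0 //.
    apply: le_lt_trans (_ : Vol allowed < +oo)%E; last first.
      exact: le_lt_trans Vol_allowed_le1 (ltry _).
    apply: le_measure; rewrite ?inE //; [apply: measurableI => //|];
      exact: measurable_allowed.
  rewrite -measureU //; last 3 first.
  - by apply: measurableI => //; exact: measurable_allowed.
  - by apply: measurableI; [exact: measurable_allowed|exact: measurableC].
  - by rewrite setIACA setICr setI0.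
  by rewrite -setIUr setUCr setIT.
have [f1 s1] := split_allowed _ (measurable_preimageT mA mB).
have [f2 s2] := split_allowed _ mB.
have [f1' _] := split_allowed _ (measurableC (measurable_preimageT mA mB)).
have [f2' _] := split_allowed _ (measurableC mB).
apply/eqP; rewrite eq_le Vol_allowed_addition_le //=.
apply: (fin_add_le_cancel f1 f1' f2 f2'); first by rewrite s1 s2.
exact: (Vol_allowed_addition_le x u0 (measurableC mB)).
Qed.

End Volume.

(** * Boxes and convolution *)

Section SetIntegrals.
Local Open Scope ereal_scope.
Context {R : realType}.

Lemma integral_indicE d (T : measurableType d) (m : {measure set T -> \bar R})
    (D : set T) (f : T -> \bar R) :
  \int[m]_(x in D) f x = \int[m]_x ((\1_D x)%:E * f x).
Proof.
rewrite integral_mkcond epatch_indic; apply: eq_integral => x _ /=.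
by rewrite muleC.
Qed.

Lemma measurable_indic_mul d (T : measurableType d) (D : set T)
    (f : T -> \bar R) : measurable D -> measurable_fun setT f ->
  measurable_fun setT (fun x => (\1_D x)%:E * f x).
Proof.
move=> mD mf; apply: emeasurable_funM => //.
by apply/measurable_EFinP; exact: measurable_indic.
Qed.

Lemma indic_mul_ge0 (T : Type) (D : set T) (f : T -> \bar R) x :
  0 <= f x -> 0 <= (\1_D x : R)%:E * f x.
Proof. by move=> f0; rewrite mule_ge0 // lee_fin. Qed.

Lemma integral_mrestr d (T : measurableType d) (m : {measure set T -> \bar R})
    (D : set T) (mD : measurable D) (f : T -> \bar R) :
  measurable_fun setT f -> (forall x, 0 <= f x) ->
  \int[mrestr m mD]_x f x = \int[m]_(x in D) f x.
Proof.
move=> mf f0; rewrite (@ge0_negligible_integral _ _ _ _ setT (~` D)) //.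
- rewrite setTD setCK; apply: eq_measure_integral => A mA AD.
  by rewrite /= /mrestr setIidl.
- exact: measurableC.
- by rewrite /= /mrestr setICl measure0.
Qed.

Lemma integral_prob1 d (T : measurableType d) (m : probability T R) (D : set T)
    (f : T -> \bar R) : measurable D -> m D = 1 ->
  measurable_fun setT f -> (forall x, 0 <= f x) ->
  \int[m]_(x in D) f x = \int[m]_x f x.
Proof.
move=> mD D1 mf f0; have N0 : m (~` D) = 0.
  by have := probability_setC m mD; rewrite D1 subee.
rewrite [RHS](@ge0_negligible_integral _ _ _ _ setT (~` D)) //.
  by rewrite setTD setCK.
exact: measurableC.
Qed.

Lemma integral_setX d1 d2 (T1 : measurableType d1) (T2 : measurableType d2)
    (m1 : {sigma_finite_measure set T1 -> \bar R})
    (m2 : {sigma_finite_measure set T2 -> \bar R})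
    (A : set T1) (B : set T2) (f : T1 * T2 -> \bar R) :
  measurable A -> measurable B ->
  measurable_fun setT f -> (forall z, 0 <= f z) ->
  \int[m1 \x m2]_(z in A `*` B) f z =
  \int[m1]_(x in A) \int[m2]_(y in B) f (x, y).
Proof.
move=> mA mB mf f0; rewrite integral_indicE fubini_tonelli1; last 2 first.
- by apply: measurable_indic_mul => //; exact: measurableX.
- by move=> z; exact: indic_mul_ge0.
rewrite [RHS]integral_indicE; apply: eq_integral => x _.
rewrite /fubini_F [X in _ * X]integral_indicE -ge0_integralZl //.
- apply: eq_integral => y _; rewrite muleA -EFinM !indicE in_setX /=.
  by rewrite -natrM mulnb.
- apply: measurable_indic_mul => //.
  exact: measurableT_comp mf (pair1_measurable x).
- by move=> y _; rewrite mule_ge0 // lee_fin.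
Qed.

End SetIntegrals.

Section VolIntegrals.
Local Open Scope ereal_scope.
Context {R : realType} {d : nat} {L : {fset 'rV[int]_d}}.
Implicit Types (eta xi zeta v w : conf R L) (x y : L).
Local Notation vol := (@lebesgue_tuple R #|{: L}|).

Lemma measurable_addcr v : measurable_fun setT (addc ^~ v : conf R L -> conf R L).
Proof.
by apply: measurable_mkconf => x; apply: measurable_funD => //; exact: measurable_height.
Qed.

Lemma measurable_addcl v : measurable_fun setT (addc v : conf R L -> conf R L).
Proof.
by apply: measurable_mkconf => x; apply: measurable_funD => //; exact: measurable_height.
Qed.

Lemma integral_Vol_shift v (f : conf R L -> \bar R) : measurable_fun setT f ->
  (forall z, 0 <= f z) ->
  \int[vol]_z f (addc z v) = \int[vol]_z f z.
Proof.
move=> mf f0.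
transitivity (\int[pushforward vol (addc ^~ v)]_z f z).
  by rewrite ge0_integral_pushforward //; exact: measurable_addcr.
apply: eq_measure_integral => [|madd A mA _].
  exact: measurable_addcr.
exact: (Vol_shift v mA).
Qed.

Definition box (al be : R) : set (conf R L) :=
  [set v | forall x, (al <= height v x <= be)%R].

Lemma measurable_itvcc (al be : R) (f : conf R L -> R) : measurable_fun setT f ->
  measurable [set v | (al <= f v <= be)%R].
Proof.
move=> mf; rewrite [X in measurable X](_ : _ = f @^-1` `[al, be]%classic).
  exact: measurable_preimageT.
by apply/seteqP; split=> v; rewrite /= in_itv.
Qed.

Lemma measurable_box al be : measurable (box al be).
Proof.
by apply: finite_forall_measurable => x; apply: measurable_itvcc;
  exact: measurable_height.
Qed.

Lemma Vol_box_itv_ge (al be : L -> R) (r : R) : (0 <= r)%R ->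
  (forall x, r <= be x - al x)%R ->
  (r ^+ #|{: L}|)%:E <= vol [set v | forall x, (al x <= height v x <= be x)%R].
Proof.
move=> r0 rab.
rewrite (_ : mkset _ = [set v | forall x, `[al x, be x]%classic (height v x)]).
  rewrite [leRHS](@Vol_box _ _ _ (fun x => `[al x, be x]%classic)); last first.
    by move=> x; exact: measurable_itv.
  have -> : (r ^+ #|{: L}|)%:E = \prod_(x : L) r%:E.
    by rewrite prodEFin prodr_const.
  suff /andP[] : 0 <= \prod_(x : L) r%:E <=
      \prod_(x : L) lebesgue_measure `[al x, be x]%classic by [].
  elim/big_ind2: _ => [|p q p' q' /andP[p0 pq] /andP[p0' pq']|x _].
  - by rewrite lexx lee_fin ler01.
  - by rewrite mule_ge0 //= lee_pmul.
  rewrite lee_fin r0 /= lebesgue_measure_itv /= lte_fin.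
  case: ifPn => h; first by rewrite -EFinB lee_fin.
  have := rab x; rewrite lee_fin; move: h; rewrite -leNgt; lra.
by apply/seteqP; split=> v /= h x; have := h x; rewrite /= in_itv.
Qed.

(* The inner integral is over w = z - v; for z in the smaller box, the v for
   which both v and z - v lie in their boxes fill a box of side at least r. *)
Lemma box_convolution (al be a b r : R) (F : conf R L -> \bar R) :
  (0 <= r)%R -> (r <= be - al)%R -> (r + r <= b - a)%R ->
  measurable_fun setT F -> (forall z, 0 <= F z) ->
  (r ^+ #|{: L}|)%:E * \int[vol]_(z in box (al + a + r) (be + b - r)) F z <=
  \int[vol]_(v in box al be) \int[vol]_(w in box a b) F (addc v w).
Proof.
move=> r0 rab rr mF F0.
pose opc v : conf R L := mkconf (fun x => - height v x)%R.
pose K (p : conf R L * conf R L) :=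
  (\1_(box al be) p.1)%:E * ((\1_(box a b) (addc p.2 (opc p.1)))%:E * F p.2).
have msub : measurable_fun setT (fun p : conf R L * conf R L => addc p.2 (opc p.1)).
  apply: measurable_mkconf => x; apply: measurable_funD.
    exact: (measurableT_comp (measurable_height x)).
  under eq_fun do rewrite height_mkconf; apply: measurableT_comp => //.
  exact: (measurableT_comp (measurable_height x)).
have mi al' be' : measurable_fun setT (fun v => (\1_(box al' be') v)%:E : \bar R).
  by apply/measurable_EFinP; apply: measurable_indic; exact: measurable_box.
have mK : measurable_fun setT K.
  apply: emeasurable_funM; first exact: (measurableT_comp (mi al be)).
  apply: emeasurable_funM; first exact: (measurableT_comp (mi a b)).
  exact: (measurableT_comp mF).
have K0 p : 0 <= K p by rewrite /K !mule_ge0 // lee_fin.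
have -> : \int[vol]_(v in box al be) \int[vol]_(w in box a b) F (addc v w) =
    \int[vol]_v \int[vol]_z K (v, z).
  rewrite integral_indicE; apply: eq_integral => v _.
  have mKv : measurable_fun setT (fun z => K (v, z)).
    exact: measurableT_comp mK (pair1_measurable v).
  rewrite -(integral_Vol_shift v mKv) // integral_indicE -ge0_integralZl //.
  - apply: eq_integral => w _; rewrite /K /=.
    have -> : addc (addc w v) (opc v) = w.
      by apply: conf_ext => x; rewrite !height_addc height_mkconf addrK.
    by congr (_ * (_ * F _)); apply: conf_ext => x; rewrite !height_addc addrC.
  - apply: measurable_indic_mul; first exact: measurable_box.
    exact: measurableT_comp mF (measurable_addcl v).
  - by move=> w _; rewrite mule_ge0 // lee_fin.
have := fubini_tonelli (m1 := vol) (m2 := vol) K mK K0.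
rewrite /fubini_F /fubini_G => ->.
rewrite integral_indicE -ge0_integralZl; first last.
- by rewrite lee_fin exprn_ge0.
- by move=> z _; exact: indic_mul_ge0.
- by apply: measurable_indic_mul => //; exact: measurable_box.
- by [].
apply: ge0_le_integral => //.
- by move=> z _; rewrite mule_ge0 ?lee_fin ?exprn_ge0 //; exact: indic_mul_ge0.
- by apply: measurable_funeM; apply: measurable_indic_mul => //; exact: measurable_box.
- exact: measurable_fun_fubini_tonelli_G.
move=> z _; rewrite indicE; case: (boolP (z \in _)) => [|_]; last first.
  by rewrite mul0e mule0 integral_ge0.
rewrite inE => zQ; rewrite mul1e.
pose D : set (conf R L) := box al be `&` [set v | box a b (addc z (opc v))].
have mD : measurable D.
  apply: measurableI; first exact: measurable_box.
  apply: (@measurable_preimageT _ _ _ _ (fun v => addc z (opc v))) (measurable_box _ _).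
  exact: (measurableT_comp msub (pair2_measurable z)).
rewrite [leRHS](_ : _ = \int[vol]_v ((\1_D v)%:E * F z)); last first.
  by apply: eq_integral => v _; rewrite /K /= muleA -EFinM !indicE in_setI -natrM mulnb.
have mD1 : measurable_fun setT (fun v => (\1_D v)%:E : \bar R).
  by apply/measurable_EFinP; exact: measurable_indic.
rewrite (ge0_integralZr _ _ mD1) //.
rewrite integral_indic // setIT; apply: lee_wpmul2r => //.
(* The coordinates of admissible [v] run over the interval from [al'] to [be']. The margins [r]
   removed from the target box are what keeps its length at least [r] when one end comes from each
   constraint. *)
pose al' x := Num.max al (height z x - b)%R.
pose be' x := Num.min be (height z x - a)%R.
have rab' x : (r <= be' x - al' x)%R.
  have /andP[z1 z2] := zQ x.
  rewrite /be' /al'; case: (leP be (height z x - a)%R) => ?;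
    case: (leP al (height z x - b)%R) => ?; lra.
apply: le_trans (Vol_box_itv_ge r0 rab') _; apply: le_measure; rewrite ?inE //.
  apply: finite_forall_measurable => x; apply: measurable_itvcc.
  exact: measurable_height.
move=> v vab; split=> x; have := vab x; rewrite /al' /be' ge_max le_min.
  by move=> /andP[/andP[-> _] /andP[-> _]].
rewrite height_addc height_mkconf => /andP[/andP[_ h1] /andP[_ h2]].
apply/andP; split; lra.
Qed.

End VolIntegrals.

(** * The transition operator *)

Section Chain.
Local Open Scope ereal_scope.
Context {R : realType} {d : nat} {L : {fset 'rV[int]_d}}.
Hypothesis hd : (0 < d)%N.
Variables (a b : R).
Hypothesis ab : (a < b)%R.
Hypothesis ha : (0 <= a)%R.
Implicit Types (eta xi zeta v w : conf R L) (x y : L) (f h : conf R L -> \bar R).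
Local Notation n := #|{: L}|.
Local Notation vol := (@lebesgue_tuple R #|{: L}|).
Local Notation U := (uniform_prob ab).

(** The Markov operator on functions, dual to the evolution of laws. With nonnegative extended
    values it can be iterated without integrability conditions, and densities need not be
    propagated. *)
Definition transition f eta : \bar R :=
  \sum_(x : L) ((n%:R^-1)%:E * \int[U]_u f (addition x u eta)).

Local Notation P := transition.

Lemma addition_stable x (u : R) eta : (0 <= u)%R -> nonneg eta ->
  stable (addition x u eta).
Proof.
move=> u0 e0; have [] // := @stabilizeP R d L hd
  (mkconf (fun y => height eta y + u * (x == y)%:R)%R).
by move=> y; rewrite height_mkconf addr_ge0 // mulr_ge0.
Qed.

Lemma measurable_addition_comp x f : measurable_fun setT f ->
  measurable_fun setT (fun p : measurableTypeR R * conf R L => f (addition x p.1 p.2)).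
Proof. by move=> mf; exact: measurableT_comp mf (measurable_addition hd x). Qed.

Lemma measurable_addition_u x f eta : measurable_fun setT f ->
  measurable_fun setT (fun u : measurableTypeR R => f (addition x u eta)).
Proof.
move=> mf.
exact: (measurableT_comp (measurable_addition_comp x mf) (pair2_measurable eta)).
Qed.

Lemma measurable_transition f : measurable_fun setT f -> (forall eta, 0 <= f eta) ->
  measurable_fun setT (P f).
Proof.
move=> mf f0; apply: emeasurable_sum => x; apply: measurable_funeM.
have := @measurable_fun_fubini_tonelli_G _ _ _ _ R U _
  (measurable_addition_comp x mf).
by apply=> p; exact: f0.
Qed.

Lemma transition_ge0 f : (forall eta, 0 <= f eta) -> forall eta, 0 <= P f eta.
Proof.
move=> f0 eta; apply: sume_ge0 => x _; apply: mule_ge0.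
  by rewrite lee_fin invr_ge0.
exact: integral_ge0.
Qed.

(** Comparison on stable configurations suffices, as inputs are at least [a] and so additions land
    there. This matters because the type [conf] also contains unstable tuples, on which the
    minorization says nothing. *)
Lemma ler_transition f h eta : measurable_fun setT f -> measurable_fun setT h ->
  (forall xi, 0 <= f xi) -> (forall xi, 0 <= h xi) ->
  (forall xi, stable xi -> f xi <= h xi) -> stable eta -> P f eta <= P h eta.
Proof.
move=> mf mh f0 h0 fh se; apply: lee_sum => x _; apply: lee_wpmul2l.
  by rewrite lee_fin invr_ge0.
rewrite !integral_uniform //; try exact: measurable_addition_u.
apply: lee_wpmul2l; first by rewrite lee_fin invr_ge0 subr_ge0 ltW.
apply: ge0_le_integral => //.
- by apply: measurable_funTS; exact: measurable_addition_u.
- by apply: measurable_funTS; exact: measurable_addition_u.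
move=> u; rewrite /= in_itv /= => /andP[au _]; apply: fh.
by apply: addition_stable; [exact: le_trans au|exact: stable_nonneg].
Qed.

Lemma transition_cstD (r : R) f eta : (0 < n)%N -> (0 <= r)%R ->
  measurable_fun setT f -> (forall xi, 0 <= f xi) ->
  P (fun xi => r%:E + f xi) eta = r%:E + P f eta.
Proof.
move=> n0 r0 mf f0; rewrite /transition.
transitivity (\sum_(x : L) ((n%:R^-1)%:E * r%:E +
    (n%:R^-1)%:E * \int[U]_u f (addition x u eta))).
  apply: eq_bigr => x _; rewrite ge0_integralD //; last exact: measurable_addition_u.
  rewrite (integral_cst U measurableT r%:E) /= probability_setT mule1 ge0_muleDr ?lee_fin //.
  exact: integral_ge0.
rewrite big_split /=; congr (_ + _).
rewrite -EFinM sumEFin; congr EFin.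
rewrite sumr_const -[LHS]mulr_natl mulrA mulfV ?mul1r //.
by rewrite pnatr_eq0 -lt0n.
Qed.

Lemma transition_site x f eta : measurable_fun setT f -> (forall xi, 0 <= f xi) ->
  (n%:R^-1 * (b - a)^-1)%:E * \int[lebesgue_measure]_(u in `[a, b]) f (addition x u eta)
  <= P f eta.
Proof.
move=> mf f0; rewrite /transition (bigD1 x) //=.
rewrite integral_uniform //; last exact: measurable_addition_u.
rewrite muleA -EFinM leeDl // sume_ge0 // => y _; apply: mule_ge0.
  by rewrite lee_fin invr_ge0.
exact: integral_ge0.
Qed.

Lemma measurable_iter_transition k f : measurable_fun setT f ->
  (forall eta, 0 <= f eta) -> measurable_fun setT (iter k P f).
Proof.
move=> mf f0; suff [] : measurable_fun setT (iter k P f) /\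
  forall eta, 0 <= iter k P f eta by [].
elim: k => //= k [mk k0]; split; last exact: transition_ge0.
exact: measurable_transition.
Qed.

Lemma iter_transition_ge0 k f : (forall eta, 0 <= f eta) ->
  forall eta, 0 <= iter k P f eta.
Proof. by move=> f0; elim: k => //= k k0; exact: transition_ge0. Qed.

Lemma ler_iter_transition k f h eta : measurable_fun setT f ->
  measurable_fun setT h ->
  (forall xi, 0 <= f xi) -> (forall xi, 0 <= h xi) ->
  (forall xi, stable xi -> f xi <= h xi) -> stable eta ->
  iter k P f eta <= iter k P h eta.
Proof.
move=> mf mh f0 h0 fh; elim: k eta => [|k IH] eta /=; first exact: fh.
apply: ler_transition => //; try exact: measurable_iter_transition.
- exact: iter_transition_ge0.
- exact: iter_transition_ge0.
Qed.

Lemma iter_transition_cstD k (r : R) f : (0 < n)%N -> (0 <= r)%R ->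
  measurable_fun setT f -> (forall xi, 0 <= f xi) ->
  iter k P (fun xi => r%:E + f xi) = fun xi => r%:E + iter k P f xi.
Proof.
move=> n0 r0 mf f0; elim: k => //= k ->; apply/funext => eta.
apply: transition_cstD => //; first exact: measurable_iter_transition.
exact: iter_transition_ge0.
Qed.

(** * Additions along a prescribed sequence of sites *)

Fixpoint add_list m : m.-tuple L -> m.-tuple R -> conf R L -> conf R L :=
  match m with
  | 0 => fun _ _ eta => eta
  | _.+1 => fun xs t eta => add_list [tuple of behead xs] [tuple of behead t]
      (addition (thead xs) (thead t) eta)
  end.

Lemma measurable_add_list m (xs : m.-tuple L) : measurable_fun setT
  (fun p : m.-tuple R * conf R L => add_list xs p.1 p.2).
Proof.
elim: m xs => [|m IH] xs /=; first exact: measurable_snd.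
pose g (p : m.+1.-tuple R * conf R L) :=
  ([tuple of behead p.1] : m.-tuple R, addition (thead xs) (thead p.1) p.2).
have mg : measurable_fun setT g.
  apply: measurable_fun_pair.
    exact: (measurableT_comp (@measurable_behead _ R m) measurable_fst).
  have m1 : measurable_fun setT
      (fun p : m.+1.-tuple R * conf R L => (thead p.1 : measurableTypeR R, p.2)).
    apply: measurable_fun_pair; last exact: measurable_snd.
    exact: (measurableT_comp (@measurable_tnth _ R m.+1 ord0) measurable_fst).
  exact: (measurableT_comp (measurable_addition hd (thead xs)) m1).
exact: (measurableT_comp (IH [tuple of behead xs]) mg).
Qed.

Lemma integral_lebesgue_tupleS m (D : set (m.+1.-tuple R)) (f : m.+1.-tuple R -> \bar R) :
  measurable D -> measurable_fun setT f -> (forall t, 0 <= f t) ->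
  \int[lebesgue_tuple m.+1]_(t in D) f t =
  \int[@lebesgue_measure R \x lebesgue_tuple m]_(p in @cons_pair R m @^-1` D)
    f (cons_pair p).
Proof.
move=> mD mf f0.
transitivity (\int[pushforward (@lebesgue_measure R \x lebesgue_tuple m)
    (@cons_pair R m)]_(t in D) f t).
  by apply: eq_measure_integral => //; exact: measurable_cons_pair.
rewrite ge0_integral_pushforward //; first exact: measurable_cons_pair.
exact: measurable_funTS.
Qed.

(** The left side is the contribution of the event that the sites drawn are exactly [xs]: each step
    costs a factor [n%:R^-1] for the site and the density [(b - a)^-1] for the input. *)
Lemma iter_transition_list m (xs : m.-tuple L) f eta :
  measurable_fun setT f -> (forall xi, 0 <= f xi) ->
  ((n%:R^-1 * (b - a)^-1) ^+ m)%:E *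
    \int[lebesgue_tuple m]_(t in [set t | forall i, (a <= tnth t i <= b)%R])
      f (add_list xs t eta)
  <= iter m P f eta.
Proof.
move=> mf f0; set k0 := (_^-1 * _)%R.
have k00 : (0 <= k0)%R by rewrite mulr_ge0 // invr_ge0 ?subr_ge0 // ltW.
have mI m' : measurable [set t : m'.-tuple R | forall i, (a <= tnth t i <= b)%R].
  apply: finite_forall_measurable => i.
  rewrite [X in measurable X](_ : _ = (fun t => tnth t i) @^-1` `[a, b]%classic).
    by apply: measurable_preimageT => //; exact: (@measurable_tnth _ R m' i).
  by apply/seteqP; split=> v; rewrite /= in_itv.
elim: m xs eta => [|m IH] xs eta.
  rewrite expr0 mul1e /= (integral_cst _ (mI 0%N) (f eta)) /=.
  by rewrite diracE; case: (_ \in _); rewrite ?mule1 // mule0.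
pose G (p : measurableTypeR R * m.-tuple R) :=
  f (add_list [tuple of behead xs] p.2 (addition (thead xs) p.1 eta)).
have mG : measurable_fun setT G.
  have m1 : measurable_fun setT (fun p : measurableTypeR R * m.-tuple R => (p.1, eta)).
    by apply: measurable_fun_pair; [exact: measurable_fst|exact: measurable_cst].
  have m2 : measurable_fun setT (fun p : measurableTypeR R * m.-tuple R =>
      (p.2, addition (thead xs) p.1 eta)).
    apply: measurable_fun_pair; first exact: measurable_snd.
    exact: (measurableT_comp (measurable_addition hd (thead xs)) m1).
  have m3 := measurableT_comp (measurable_add_list [tuple of behead xs]) m2.
  exact: (measurableT_comp mf m3).
have mPf := measurable_iter_transition m mf f0.
have Pf0 := iter_transition_ge0 m f0.
rewrite iterS; apply: le_trans (transition_site (thead xs) eta mPf Pf0).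
rewrite -/k0 exprS EFinM -muleA; apply: lee_wpmul2l; first by rewrite lee_fin.
rewrite integral_lebesgue_tupleS //; last first.
  have m1 := measurableT_comp (measurable_add_list xs) (pair2_measurable eta).
  exact: (measurableT_comp mf m1).
rewrite (_ : _ @^-1` _ = `[a, b]%classic `*`
    [set t : m.-tuple R | forall i, (a <= tnth t i <= b)%R]); last first.
  apply/seteqP; split=> -[u t] /=; rewrite in_itv /=.
    move=> h; split; first by have := h ord0; rewrite tnth0.
    by move=> i; have := h (lift ord0 i); rewrite tnthS.
  by move=> [hu ht] i; case: (unliftP ord0 i) => [j ->|->]; rewrite ?tnthS ?tnth0.
rewrite (eq_integral G); last first.
  move=> [u t] _; rewrite /G /= theadE; congr (f (add_list _ _ _)).
  exact/val_inj.
rewrite integral_setX //; last by move=> p; exact: f0.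
have mJ : measurable_fun setT (fun u : measurableTypeR R =>
    \int[lebesgue_tuple m]_(t in [set t | forall i, (a <= tnth t i <= b)%R]) G (u, t)).
  under eq_fun do rewrite integral_indicE.
  have mG' : measurable_fun setT (fun p : measurableTypeR R * m.-tuple R =>
      (\1_([set t : m.-tuple R | forall i, (a <= tnth t i <= b)%R]) p.2)%:E * G p).
    apply: emeasurable_funM => //; apply/measurable_EFinP.
    have m1 := @measurable_indic _ _ R setT _ (mI m).
    exact: (measurableT_comp m1 measurable_snd).
  have := @measurable_fun_fubini_tonelli_F _ _ _ _ R (lebesgue_tuple m) _ mG'.
  by apply=> p; rewrite mule_ge0 ?lee_fin // /G.
have J0 u : 0 <= \int[lebesgue_tuple m]_(t in [set t | forall i, (a <= tnth t i <= b)%R]) G (u, t).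
  by apply: integral_ge0 => t _; exact: f0.
rewrite -(ge0_integralZl _ _ (measurable_funTS mJ)) //; last by rewrite lee_fin exprn_ge0.
apply: ge0_le_integral => //.
- by move=> u _; apply: mule_ge0; [rewrite lee_fin exprn_ge0|exact: J0].
- by apply: measurable_funTS; exact: measurable_funeM.
- by apply: measurable_funTS; exact: measurable_addition_u.
- by move=> u _; exact: (IH [tuple of behead xs] (addition (thead xs) u eta)).
exact: mI.
Qed.

End Chain.

(** * Doeblin minorization *)

Section Doeblin.
Local Open Scope ereal_scope.
Context {R : realType} {d : nat} {L : {fset 'rV[int]_d}}.
Hypothesis hd : (0 < d)%N.
Variables (a b : R).
Hypothesis ab : (a < b)%R.
Hypothesis ha : (0 <= a)%R.
Implicit Types (eta xi zeta v w : conf R L) (x y : L) (f h : conf R L -> \bar R).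
Local Notation n := #|{: L}|.
Local Notation vol := (@lebesgue_tuple R #|{: L}|).
Local Notation P := (@transition R d L a b ab).

Lemma add_listE m (xs : m.-tuple L) (t : m.-tuple R) eta : stable eta ->
  (forall i, 0 <= tnth t i)%R ->
  add_list xs t eta = stabilize (addc eta
    (mkconf (fun y => \sum_(i < m) tnth t i * (tnth xs i == y)%:R)%R)).
Proof.
elim: m xs t eta => [|m IH] xs t eta se t0.
  apply/esym/(stabilize_eq hd) => //=.
  rewrite (_ : addc _ _ = eta); first exact: legal_nil.
  by apply: conf_ext => y; rewrite height_addc height_mkconf big_ord0 addr0.
have t0' i : (0 <= tnth [tuple of behead t] i)%R by rewrite tnth_behead.
have th0 : (0 <= thead t)%R by exact: t0.
rewrite /= IH //; last exact: (addition_stable hd _ th0 (stable_nonneg se)).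
rewrite additionE (stabilize_addc hd) //.
- congr stabilize; apply: conf_ext => y; rewrite !(height_addc, height_mkconf).
  rewrite big_ord_recl; congr (_ + (_ + _))%R.
  apply: eq_bigr => i _; rewrite !tnth_behead.
  by rewrite (_ : inord _ = lift ord0 i) //; apply/val_inj; rewrite /= inordK // ltnS.
- exact: stable_nonneg.
- by move=> y; rewrite height_mkconf mulr_ge0.
- by move=> y; rewrite height_mkconf sumr_ge0 // => i _; rewrite mulr_ge0.
Qed.

Lemma measurable_stabilize_addc f eta : measurable_fun setT f ->
  measurable_fun setT (fun v => f (stabilize (addc eta v))).
Proof.
move=> mf.
have m1 := measurableT_comp (measurable_stabilize hd) (measurable_addcl eta).
exact: (measurableT_comp mf m1).
Qed.

Let k0 : R := (n%:R^-1 * (b - a)^-1)%R.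

Lemma transition_block f eta : measurable_fun setT f ->
  (forall xi, 0 <= f xi) -> stable eta ->
  (k0 ^+ n)%:E * \int[vol]_(v in box a b) f (stabilize (addc eta v)) <=
  iter n P f eta.
Proof.
move=> mf f0 se.
(* Each site once, in the order of the enumeration, so that the tuple of inputs is itself the
   configuration added. *)
pose xs := [tuple enum_val i | i < n] : n.-tuple L.
apply: le_trans (iter_transition_list hd ab xs eta mf f0).
rewrite (_ : box a b = [set t | forall i, (a <= tnth t i <= b)%R]); last first.
  apply/seteqP; split=> t /= h x; last exact: h.
  by have := h (enum_val x); rewrite /height enum_valK.
rewrite (eq_integral (fun t => f (add_list xs t eta))) // => t; rewrite inE /= => tab.
congr f; rewrite add_listE //; last first.
  by move=> i; have /andP[h _] := tab i; exact: le_trans h.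
congr stabilize; apply: conf_ext => y; rewrite !height_addc height_mkconf.
congr (_ + _)%R; rewrite (bigD1 (enum_rank y)) //= tnth_mktuple enum_rankK eqxx.
rewrite mulr1 big1 ?addr0 // => i ne; rewrite tnth_mktuple.
by case: eqP => [h|]; rewrite ?mulr0 // -h enum_valK eqxx in ne *.
Qed.

(** Convolution with the box from [a] to [b] moves the ends by [a + r] and [b - r], so the side
    grows by [b - a - 2 * r]. Taking a quarter of [b - a] makes this increment [2 * r], and the
    lower end still advances by at least [r] when [a] is 0. *)
Let r : R := ((b - a) / 4)%R.
Let al (k : nat) : R := (a + k%:R * (a + r))%R.
Let be (k : nat) : R := (b + k%:R * (b - r))%R.

Let side_boxes k : (be k - al k = 4 * r + 2 * (k%:R * r))%R.
Proof. by rewrite /al /be /r; field. Qed.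

Let r_gt0 : (0 < r)%R.
Proof. by rewrite divr_gt0 // subr_gt0. Qed.

Let r2_le : (r + r <= b - a)%R.
Proof. by rewrite (_ : b - a = 4 * r)%R; [move: r_gt0; lra|rewrite /r; field]. Qed.

Let r_le_side k : (r <= be k - al k)%R.
Proof.
rewrite side_boxes; have : (0 <= (k%:R : R) * r)%R by rewrite mulr_ge0 // ltW.
by move: r_gt0; lra.
Qed.

Let al_succ k : al k.+1 = (al k + a + r)%R.
Proof. by rewrite /al -natr1; ring. Qed.

Let be_succ k : be k.+1 = (be k + b - r)%R.
Proof. by rewrite /be -natr1; ring. Qed.

(** The induction appends one more block of additions, one per site. By [stabilize_addc] its input
    [w] merges with the earlier total [v], and [box_convolution] bounds the resulting double
    integral. *)
Lemma transition_boxes k : exists2 C : R, (0 < C)%R &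
  forall f eta, measurable_fun setT f -> (forall xi, 0 <= f xi) -> stable eta ->
  C%:E * \int[vol]_(v in box (al k) (be k)) f (stabilize (addc eta v)) <=
  iter (k.+1 * n)%N P f eta.
Proof.
have n0 : (0 < n)%N \/ n = 0%N by case: n; [right|left].
have r0 := r_gt0.
have k0ge : (0 <= k0 ^+ n)%R by rewrite exprn_ge0 // mulr_ge0 // invr_ge0 // subr_ge0 ltW.
have k0gt : (0 < k0 ^+ n)%R.
  case: n0 => [n0|->]; last by rewrite expr0.
  by rewrite exprn_gt0 // mulr_gt0 // invr_gt0 ?ltr0n // subr_gt0.
elim: k => [|k [C C0 IH]].
  exists (k0 ^+ n)%R => // f eta mf f0 se.
  by rewrite mul1n /al /be !mul0r !addr0; exact: transition_block.
have al0 : (0 <= al k)%R.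
  by rewrite addr_ge0 // mulr_ge0 // addr_ge0 // ltW.
exists (C * k0 ^+ n * r ^+ n)%R; first by rewrite !mulr_gt0 // exprn_gt0.
move=> f eta mf f0 se.
have mf1 := measurable_iter_transition hd ab n mf f0.
have f10 := iter_transition_ge0 ab n f0.
rewrite mulSn addnC iterD; apply: le_trans (IH _ eta mf1 f10 se).
rewrite -mulrA EFinM -muleA; apply: lee_wpmul2l; first by rewrite lee_fin ltW.
pose F z := f (stabilize (addc eta z)).
have mF : measurable_fun setT F by exact: measurable_stabilize_addc.
have F0 z : 0 <= F z by exact: f0.
have cv : (r ^+ n)%:E * \int[vol]_(z in box (al k.+1) (be k.+1)) F z <=
    \int[vol]_(v in box (al k) (be k)) \int[vol]_(w in box a b) F (addc v w).
  rewrite al_succ be_succ; apply: box_convolution => //; exact: ltW.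
rewrite EFinM -muleA; apply: le_trans (lee_wpmul2l _ cv) _; first by rewrite lee_fin.
have mI : measurable_fun setT (fun v => \int[vol]_(w in box a b) F (addc v w)).
  under eq_fun do rewrite integral_indicE.
  have mG : measurable_fun setT (fun p : conf R L * conf R L =>
      (\1_(box a b) p.2)%:E * F (addc p.1 p.2)).
    apply: emeasurable_funM; last exact: (measurableT_comp mF (@measurable_addc2 R d L)).
    apply/measurable_EFinP.
    have m1 := @measurable_indic _ _ R setT _ (@measurable_box R d L a b).
    exact: (measurableT_comp m1 measurable_snd).
  have := @measurable_fun_fubini_tonelli_F _ _ _ _ R vol _ mG.
  by apply=> p; rewrite mule_ge0 ?lee_fin.
have I0 v : 0 <= \int[vol]_(w in box a b) F (addc v w).
  by apply: integral_ge0 => w _; exact: F0.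
have mB := @measurable_box R d L (al k) (be k).
rewrite -(ge0_integralZl _ _ (measurable_funTS mI)) //.
apply: ge0_le_integral => //.
- by move=> v _; apply: mule_ge0; [rewrite lee_fin|exact: I0].
- by apply: measurable_funTS; exact: measurable_funeM.
- by apply: measurable_funTS; exact: measurable_stabilize_addc.
move=> v vk; have v0 : nonneg v.
  by move=> x; have /andP[h _] := vk x; exact: le_trans h.
have [_ ss] := stabilizeP hd (nonneg_addc (stable_nonneg se) v0).
apply: le_trans (transition_block mf f0 ss); apply: lee_wpmul2l; first by rewrite lee_fin.
rewrite le_eqVlt; apply/orP; left; apply/eqP; apply: eq_integral => w; rewrite inE => wab.
rewrite /F stabilize_addc //; first exact: stable_nonneg.
by move=> x; have /andP[h _] := wab x; exact: le_trans h.
Qed.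

(* A box of side at least 4 contains, up to a single lattice translation, every
   difference of two stable configurations; above height 1 every site topples,
   so that the result of the stabilization is the allowed representative. *)
Lemma doeblin_allowed : exists N : nat, exists2 C : R, (0 < C)%R &
  forall f eta, measurable_fun setT f -> (forall xi, 0 <= f xi) -> stable eta ->
  C%:E * \int[vol]_(z in allowed) f z <= iter N P f eta.
Proof.
have r0 := r_gt0.
(* This makes [k%:R * r] at least 2, which serves twice: the lower end [al k] passes 1 and the side
   reaches 4. *)
pose k := (Num.truncn (2 / r)).+1.
have kr : (2 <= k%:R * r)%R.
  by rewrite -ler_pdivrMr // ltW // truncnS_gt.
have al1 : (1 <= al k)%R.
  rewrite /al mulrDr addrA (le_trans (_ : 1 <= k%:R * r)%R) ?lerDr ?addr_ge0 ?mulr_ge0 //.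
  by apply: le_trans kr; rewrite ler1n.
have abk : (4 <= be k - al k)%R.
  rewrite side_boxes -[leLHS]add0r lerD //; first by rewrite mulr_ge0 // ltW.
  by rewrite (_ : 4 = 2 * 2)%R ?ler_pM2l //; ring.
have [C C0 HC] := transition_boxes k.
exists (k.+1 * n)%N; exists C => // f eta mf f0 se.
apply: le_trans (HC f eta mf f0 se); apply: lee_wpmul2l; first by rewrite lee_fin ltW.
have [h [h1 h0]] := @green_exists R d L hd.
(* The centre of the box. Since [lap h] is 1, the real odometer [c * h] has [lap] equal to [c]; its
   integer part [m] misses this by at most 1. *)
pose c := ((al k + be k) / 2)%R.
pose m x : int := Num.floor (c * h x).
have lapm y : (c - 1 <= lap (fun x => (m x)%:~R) y <= c + 1)%R.
  pose e x : R := (c * h x - (m x)%:~R)%R.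
  have e01 x : (0 <= e x <= 1)%R.
    rewrite /e subr_ge0 floor_le_tmp /=.
    by rewrite lerBlDl; have := floorD1_gt (c * h x)%R; rewrite intrD => /ltW.
  have -> : lap (fun x => (m x)%:~R) y = (c - lap e y)%R.
    have -> : lap e y = (lap (fun x => c * h x)%R y - lap (fun x => (m x)%:~R) y)%R.
      exact: lapB.
    have -> : lap (fun x => c * h x)%R y = (c * lap h y)%R.
      by rewrite /lap mulr_sumr; apply: eq_bigr => z _; rewrite mulrA.
    by rewrite h1 mulr1; ring.
  have := lap_ge hd y e01; have : (lap e y <= e y)%R.
    by apply: lap_le => // z; have /andP[] := e01 z.
  have /andP[_] := e01 y; set u := lap e y; set u' := e y; lra.
(* Adding [z] and [p] to [eta] yields [z] plus [lap m], a configuration in the lattice class of [z].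
   Translating the variable by [p] thus turns an integral over the box into one over allowed [z]. *)
pose p : conf R L := mkconf (fun y => lap (fun x => (m x)%:~R) y - height eta y)%R.
pose F z := f (stabilize (addc eta z)).
have mF : measurable_fun setT F by exact: measurable_stabilize_addc.
have mB := @measurable_box R d L (al k) (be k).
rewrite (integral_indicE _ allowed) (integral_indicE _ (box _ _)).
rewrite -(@integral_Vol_shift _ _ _ p (fun v => (\1_(box (al k) (be k)) v)%:E * F v)); first last.
- by move=> z; rewrite mule_ge0 ?lee_fin // /F.
- exact: measurable_indic_mul.
apply: ge0_le_integral => //.
- by move=> z _; rewrite mule_ge0 ?lee_fin.
- by apply: measurable_indic_mul => //; exact: measurable_allowed.
- apply: (measurableT_comp (measurable_indic_mul mB mF)); exact: measurable_addcr.
move=> z _; rewrite indicE; case: (boolP (z \in _)) => [|_]; last first.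
  by rewrite mul0e mule_ge0 ?lee_fin // /F.
rewrite inE => az; have [sz _] := az.
have bz : box (al k) (be k) (addc z p).
  move=> x; rewrite height_addc height_mkconf.
  have /andP[l1 l2] := lapm x; have /andP[z1 z2] := sz x; have /andP[e1 e2] := se x.
  by move: l1 l2; rewrite /c => l1 l2; apply/andP; split; lra.
rewrite !mul1e indicE mem_set // mul1e /F.
suff -> : stabilize (addc eta (addc z p)) = z by [].
set q := addc eta (addc z p).
have qE y : height q y = (height z y + lap (fun x => (m x)%:~R) y)%R.
  by rewrite !height_addc height_mkconf; ring.
have q1 y : (1 <= height q y)%R.
  rewrite height_addc; have /andP[h2 _] := bz y; have /andP[e1 _] := se y.
  by rewrite (le_trans al1) // (le_trans h2) // lerDr.
have q0 : nonneg q by move=> y; exact: le_trans (q1 y).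
have aq := stabilize_ge1_allowed hd q1.
have [k' k'E] := stabilize_lap hd q0.
apply: (@allowed_unique _ _ _ hd _ _ (fun x => m x - (k' x)%:Z)%R) => // y.
rewrite k'E qE.
have -> : (fun x => (m x - (k' x)%:Z)%:~R : R)%R = (fun x => (m x)%:~R - (k' x)%:R)%R.
  by apply/funext => x; rewrite intrB.
by rewrite lapB addrA.
Qed.

End Doeblin.

(** * Invariance and contraction *)

Section Mixing.
Local Open Scope ereal_scope.
Context {R : realType} {d : nat} {L : {fset 'rV[int]_d}}.
Hypothesis hd : (0 < d)%N.
Hypothesis L0 : (0 < #|{: L}|)%N.
Variables (a b : R).
Hypothesis ab : (a < b)%R.
Hypothesis ha : (0 <= a)%R.
Implicit Types (eta xi zeta v w : conf R L) (x y : L) (f h : conf R L -> \bar R).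
Local Notation n := #|{: L}|.
Local Notation vol := (@lebesgue_tuple R #|{: L}|).
Local Notation U := (uniform_prob ab).
Local Notation P := (@transition R d L a b ab).

(* The Dirac mass is a junk value, for an allowed set of zero volume. *)
Definition allowed_prob : probability (conf R L) R :=
  mnormalize (mrestr vol (@measurable_allowed R d L)) (\d_(mkconf (fun=> 0%R))).

Local Notation mu := allowed_prob.

Let V : R := fine (@Vol R d L allowed).

Let VE : @Vol R d L allowed = V%:E.
Proof.
rewrite /V fineK // ge0_fin_numE ?measure_ge0 //.
exact: le_lt_trans (@Vol_allowed_le1 R d L) (ltry _).
Qed.

Let V_gt0 : (0 < V)%R.
Proof. by rewrite -lte_fin -VE; exact: Vol_allowed_gt0. Qed.

Lemma allowed_probE B : mu B = V^-1%:E * Vol (allowed `&` B).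
Proof.
have VT : mrestr vol (@measurable_allowed R d L) setT = V%:E.
  by rewrite /mrestr setTI; exact: VE.
rewrite /= /mnormalize /= VT eqe gt_eqF //= muleC.
by rewrite /mrestr setIC.
Qed.

Lemma allowed_prob_mu_allowed B : mu B = mu_allowed B.
Proof.
rewrite allowed_probE /mu_allowed VE inver gt_eqF // muleC; by rewrite setIC.
Qed.

Lemma allowed_prob_stable : mu stable = 1.
Proof.
rewrite allowed_probE setIidl; last by move=> eta [].
by rewrite VE -EFinM mulVf // gt_eqF.
Qed.

Lemma integral_allowed_prob f : measurable_fun setT f -> (forall xi, 0 <= f xi) ->
  \int[mu]_eta f eta = V^-1%:E * \int[vol]_(eta in allowed) f eta.
Proof.
move=> mf f0; have Vi : (0 <= V^-1)%R by rewrite invr_ge0 ltW.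
rewrite -(integral_mrestr _ (@measurable_allowed R d L) mf f0).
rewrite -(ge0_integral_mscale _ measurableT (NngNum Vi)) //.
apply: eq_measure_integral => B mB _; rewrite [LHS]allowed_probE.
by rewrite /= /mscale /= /mrestr setIC.
Qed.

Lemma integral_allowed_prob_addition x (u : R) f : (0 <= u)%R ->
  measurable_fun setT f -> (forall xi, 0 <= f xi) ->
  \int[mu]_eta f (addition x u eta) = \int[mu]_eta f eta.
Proof.
move=> u0 mf f0.
have mA : measurable_fun setT (addition x u : conf R L -> conf R L).
  exact: (measurableT_comp (measurable_addition hd x) (pair1_measurable (u : measurableTypeR R))).
transitivity (\int[pushforward mu (addition x u)]_eta f eta).
  by rewrite ge0_integral_pushforward.
apply: eq_measure_integral => // B mB _.
rewrite [RHS]allowed_probE [LHS]allowed_probE; congr (_ * _).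
exact: Vol_allowed_addition.
Qed.

Lemma integral_transition (pi : probability (conf R L) R) f :
  measurable_fun setT f -> (forall xi, 0 <= f xi) ->
  \int[pi]_eta P f eta = \sum_(x : L) (n%:R^-1)%:E *
     \int[U \x pi]_p f (addition x p.1 p.2).
Proof.
move=> mf f0; have mx x := measurable_addition_comp hd x mf.
have mG x := @measurable_fun_fubini_tonelli_G _ _ _ _ R U _ (mx x) (fun p => f0 _).
have c0 : 0 <= (n%:R^-1 : R)%:E by rewrite lee_fin invr_ge0.
have G0 x eta : 0 <= \int[U]_u f (addition x u eta) by exact: integral_ge0.
rewrite /transition ge0_integral_sum //.
- apply: eq_bigr => x _; rewrite ge0_integralZl //; last exact: mG.
  by rewrite fubini_tonelli2.
- by move=> x; apply: measurable_funeM; exact: mG.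
- by move=> x eta _; rewrite mule_ge0.
Qed.

Lemma integral_allowed_prob_transition f :
  measurable_fun setT f -> (forall xi, 0 <= f xi) ->
  \int[mu]_eta P f eta = \int[mu]_eta f eta.
Proof.
move=> mf f0; rewrite integral_transition //.
rewrite (eq_bigr (fun=> (n%:R^-1)%:E * \int[mu]_eta f eta)); last first.
  move=> x _; have mx := measurable_addition_comp hd x mf.
  congr (_ * _); rewrite fubini_tonelli1 //.
  have mF := @measurable_fun_fubini_tonelli_F _ _ _ _ R mu _ mx (fun p => f0 _).
  rewrite integral_uniform //; last by move=> u; exact: integral_ge0.
  rewrite (eq_integral (cst (\int[mu]_eta f eta))); last first.
    move=> u; rewrite inE /= in_itv /= => /andP[au _].
    rewrite /fubini_F /=; apply: integral_allowed_prob_addition => //.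
    exact: le_trans au.
  rewrite integral_cst //= lebesgue_measure_itv /= lte_fin ab -EFinB.
  by rewrite muleCA -EFinM mulVf ?mule1 // subr_eq0 gt_eqF.
rewrite -ge0_sume_distrl; last by move=> x _; rewrite lee_fin invr_ge0.
rewrite sumEFin sumr_const -[X in X%:E]mulr_natl mulfV ?mul1e //.
by rewrite pnatr_eq0 -lt0n.
Qed.

Lemma cbtw_kernelE eta B : measurable B ->
  cbtw_kernel ab eta B = P (fun xi => (\1_B xi)%:E) eta.
Proof.
move=> mB; rewrite /cbtw_kernel /transition; apply: eq_bigr => x _; congr (_ * _).
have mu_ : measurable_fun setT (fun u : measurableTypeR R => addition x u eta).
  exact: (measurableT_comp (measurable_addition hd x) (pair2_measurable eta)).
have mB' : measurable ((fun u : measurableTypeR R => addition x u eta) @^-1` B).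
  exact: measurable_preimageT.
transitivity (\int[U]_u (\1_((fun u : measurableTypeR R => addition x u eta) @^-1` B) u)%:E).
  by rewrite integral_indic // setIT.
by apply: eq_integral => u _; rewrite !indicE; congr (_%:R%:E).
Qed.

Lemma measurable_indicE B : measurable B ->
  measurable_fun setT (fun xi : conf R L => (\1_B xi : R)%:E).
Proof. by move=> mB; apply/measurable_EFinP; exact: measurable_indic. Qed.

Lemma allowed_prob_invariant : cbtw_invariant ab mu.
Proof.
move=> B mB; under eq_integral do rewrite cbtw_kernelE //.
have m1 := measurable_indicE mB.
have p1 xi : 0 <= (\1_B xi : R)%:E by rewrite lee_fin.
rewrite integral_prob1 //; first last.
- exact: transition_ge0.
- exact: measurable_transition.
- exact: allowed_prob_stable.
- exact: measurable_stable.
by rewrite integral_allowed_prob_transition // integral_indic // setIT.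
Qed.

(* The law after one step is a finite combination of image measures, so that a
   statement about sets extends to nonnegative measurable functions. *)
Lemma integral_law_succ (pi pi' : probability (conf R L) R) f :
  (forall B, measurable B -> pi' B = \int[pi]_eta P (fun xi => (\1_B xi)%:E) eta) ->
  measurable_fun setT f -> (forall xi, 0 <= f xi) ->
  \int[pi']_eta f eta = \int[pi]_eta P f eta.
Proof.
move=> pi'E mf f0.
have [x0 _] : exists x0 : L, x0 \in {: L} by apply/card_gt0P.
pose A k (p : measurableTypeR R * conf R L) := addition (nth x0 (enum {: L}) k) p.1 p.2.
have mA k : measurable_fun setT (A k) by exact: measurable_addition.
pose m_ k : {measure set (conf R L) -> \bar R} :=
  measure_function_pushforward__canonical__measure_function_Measure (U \x pi) (mA k).
have c0 : (0 <= n%:R^-1 :> R)%R by rewrite invr_ge0.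
pose M := mscale (NngNum c0) (msum m_ n).
have ME h : measurable_fun setT h -> (forall xi, 0 <= h xi) ->
    \int[pi]_eta P h eta = \int[M]_eta h eta.
  move=> mh h0; rewrite integral_transition // /M ge0_integral_mscale //=.
  rewrite ge0_integral_measure_sum // -ge0_sume_distrr; last first.
    by move=> x _; exact: integral_ge0.
  congr (_ * _); rewrite -big_enum /= (big_nth x0) big_mkord -cardE.
  apply: eq_bigr => k _; rewrite ge0_integral_pushforward //.
rewrite ME //; apply: eq_measure_integral => B mB _.
have m1 := measurable_indicE mB.
have p1 xi : 0 <= (\1_B xi : R)%:E by rewrite lee_fin.
apply: etrans (pi'E _ mB) _.
by rewrite ME // integral_indic // setIT.
Qed.

(** Invariance makes [pi] its own law after one step, so [integral_law_succ] applies with both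
    measures equal; restricting to [stable] changes nothing since [pi] is carried by it. *)
Lemma invariant_integral (pi : probability (conf R L) R) f :
  pi stable = 1 -> cbtw_invariant ab pi ->
  measurable_fun setT f -> (forall xi, 0 <= f xi) ->
  \int[pi]_eta P f eta = \int[pi]_eta f eta.
Proof.
move=> ps pinv mf f0; apply/esym/integral_law_succ => // B mB.
have m1 := measurable_indicE mB.
have p1 xi : 0 <= (\1_B xi : R)%:E by rewrite lee_fin.
have mP1 := measurable_transition hd ab m1 p1.
have P10 := transition_ge0 ab p1.
rewrite -(integral_prob1 (@measurable_stable R d L) ps mP1 P10).
apply: etrans (esym (pinv _ mB)) _.
by apply: eq_integral => eta _; rewrite cbtw_kernelE.
Qed.

Lemma integral_iter_transition (pi : probability (conf R L) R) k f :
  (forall h, measurable_fun setT h -> (forall xi, 0 <= h xi) ->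
     \int[pi]_eta P h eta = \int[pi]_eta h eta) ->
  measurable_fun setT f -> (forall xi, 0 <= f xi) ->
  \int[pi]_eta iter k P f eta = \int[pi]_eta f eta.
Proof.
move=> pinv mf f0; elim: k => //= k <-; apply: pinv.
  exact: measurable_iter_transition.
exact: iter_transition_ge0.
Qed.

(** The extra step, absorbed by invariance of [mu], makes the number of steps positive, so that a
    rate per step can be formed by dividing by it. *)
Lemma doeblin : exists N : nat, exists2 e : R, (0 < e < 1)%R &
  forall f eta, measurable_fun setT f -> (forall xi, 0 <= f xi) -> stable eta ->
  e%:E * \int[mu]_xi f xi <= iter N.+1 P f eta.
Proof.
have [N [C C0 HC]] := @doeblin_allowed R d L hd a b ab ha.
(* [C * V] converts volume into [mu]; the cap at one half keeps the constant below 1. *)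
exists N; exists (Num.min (C * V) 2^-1)%R.
  rewrite lt_min mulr_gt0 //= invr_gt0 ltr0n /=.
  by rewrite gt_min invf_lt1 ?ltr1n ?orbT.
move=> f eta mf f0 se; rewrite iterSr.
have mPf := measurable_transition hd ab mf f0.
have Pf0 := transition_ge0 ab f0.
apply: le_trans (HC _ _ mPf Pf0 se).
rewrite -integral_allowed_prob_transition // integral_allowed_prob //.
rewrite muleA -EFinM; apply: lee_wpmul2r; first exact: integral_ge0.
by rewrite lee_fin ler_pdivrMr // ge_min lexx.
Qed.

(* Each round of N steps closes a fraction e of the gap to the mean. *)
Lemma iter_transition_lower (N : nat) (e : R) : (0 < e < 1)%R ->
  (forall f eta, measurable_fun setT f -> (forall xi, 0 <= f xi) -> stable eta ->
    e%:E * \int[mu]_xi f xi <= iter N P f eta) ->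
  forall j f eta, measurable_fun setT f -> (forall xi, 0 <= f xi) ->
  \int[mu]_xi f xi \is a fin_num -> stable eta ->
  (1 - (1 - e) ^+ j)%:E * \int[mu]_xi f xi <= iter (j * N) P f eta.
Proof.
move=> /andP[e0 e1] HN; elim=> [|j IH] f eta mf f0 fin se.
  by rewrite expr0 subrr mul0e.
set m := fine (\int[mu]_xi f xi).
have mE : \int[mu]_xi f xi = m%:E by rewrite /m fineK.
have m0 : (0 <= m)%R by rewrite -lee_fin -mE; exact: integral_ge0.
have r0 : (0 <= 1 - (1 - e) ^+ j)%R.
  by rewrite subr_ge0 exprn_ile1 // ?subr_ge0 ?(ltW e1) // lerBlDr lerDl ltW.
set c := ((1 - (1 - e) ^+ j) * m)%R.
have c0 : (0 <= c)%R by rewrite mulr_ge0.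
pose h := iter (j * N) P f.
have mh : measurable_fun setT h by exact: measurable_iter_transition.
have h0 : forall xi, 0 <= h xi by exact: iter_transition_ge0.
(* The excess over the constant [c] granted by the induction hypothesis. Truncating at 0 keeps it
   nonnegative off [stable], where that hypothesis is silent. Minorizing this excess alone gives
   [c + e * (m - c)], the bound for the next round. *)
pose h' xi := maxe (h xi - c%:E) 0.
have mh' : measurable_fun setT h'.
  apply: measurable_maxe => //; apply: emeasurable_funB => //.
have h'0 xi : 0 <= h' xi by rewrite /h' le_max lexx orbT.
have hh' xi : h xi <= c%:E + h' xi.
  by rewrite -leeBlDl // /h' le_max lexx.
have h'h xi : stable xi -> c%:E + h' xi <= h xi.
  move=> sx; have := IH f xi mf f0 fin sx; rewrite mE -EFinM -/c -/(h xi) => ch.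
  by rewrite /h' max_l ?suber_ge0 // addeC subeK.
have mch' : measurable_fun setT (fun xi => c%:E + h' xi) by exact: emeasurable_funD.
have ch'0 xi : 0 <= c%:E + h' xi by rewrite adde_ge0 // lee_fin.
rewrite mulSn iterD.
apply: le_trans (ler_iter_transition hd ab ha N mch' mh ch'0 h0 h'h se).
rewrite iter_transition_cstD //.
apply: le_trans (leeD2l _ (HN h' eta mh' h'0 se)).
have : m%:E <= c%:E + \int[mu]_xi h' xi.
  rewrite -mE -(integral_iter_transition (j * N) _ mf f0); last first.
    exact: integral_allowed_prob_transition.
  rewrite -[c%:E]mule1 -(probability_setT mu) -integral_cst //.
  rewrite -ge0_integralD //.
  exact: ge0_le_integral.
have : 0 <= \int[mu]_xi h' xi by exact: integral_ge0.
rewrite mE; case: (\int[mu]_xi h' xi) => [q| |] //.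
  rewrite -!EFinM -!EFinD !lee_fin => q0 mq.
  have : (e * m <= e * (c + q))%R by rewrite ler_pM2l.
  rewrite exprS /c; set s := ((1 - e) ^+ j)%R; nra.
by move=> _ _; rewrite gt0_muley ?lte_fin // addey // leey.
Qed.

End Mixing.

(** * The law of the process *)

Section ScaledProduct.
Local Open Scope ereal_scope.
Context {R : realType}.

(** Meant for a joint law restricted to an independent event, whose mass is [k] instead of 1.
    Dividing by [k] reduces it to uniqueness of the product measure; a null event is handled
    apart. *)
Lemma scaled_product_unique d1 d2 (T1 : measurableType d1) (T2 : measurableType d2)
    (m1 : probability T1 R) (m2 : probability T2 R)
    (m : {measure set (T1 * T2) -> \bar R}) (k : R) : (0 <= k)%R ->
  (forall A B, measurable A -> measurable B ->
     m (A `*` B) = k%:E * (m1 A * m2 B)) ->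
  forall C, measurable C -> m C = k%:E * (m1 \x m2) C.
Proof.
rewrite le_eqVlt => /predU1P[<-|k0] mE C mC.
  rewrite mul0e; apply/eqP; rewrite eq_le measure_ge0 andbT.
  apply: (@le_trans _ _ (m (setT `*` setT))); last by rewrite mE // mul0e.
  by apply: le_measure; rewrite ?inE // -?setXTT //; exact: measurableX.
have ki : (0 <= k^-1)%R by rewrite invr_ge0 ltW.
have := @product_measure_unique _ _ _ _ R m1 m2 (mscale (NngNum ki) m) _ C mC.
rewrite /= /mscale /= => -> => [|A B mA mB].
  by rewrite muleA -EFinM mulfV ?mul1e // gt_eqF.
by rewrite mE // muleA -EFinM mulVf ?mul1e // gt_eqF.
Qed.

Lemma measure_partition d (T : measurableType d) (m : {measure set T -> \bar R})
    (I : finType) (X : T -> I) (A : set T) :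
  (forall x, measurable (X @^-1` [set x])) -> measurable A ->
  m A = \sum_(x : I) m (A `&` X @^-1` [set x]).
Proof.
move=> mX mA; rewrite -big_enum /= (fsbig_seq _ _ (enum_uniq I)).
rewrite -measure_fin_bigcup //.
- congr (m _); apply/seteqP; split=> [w Aw|w [x _ []]] //.
  by exists (X w) => //=; rewrite mem_enum.
- by move=> x y _ _ [w [[_ <-] [_ <-]]].
- by move=> x _; exact: measurableI.
Qed.

End ScaledProduct.

Section Process.
Local Open Scope ereal_scope.
Context {R : realType} {d : nat} {L : {fset 'rV[int]_d}}.
Hypothesis hd : (0 < d)%N.
Hypothesis L0 : (0 < #|{: L}|)%N.
Variables (a b : R).
Hypothesis ab : (a < b)%R.
Context {disp : measure_display} {T : measurableType disp}.
Variables (P : probability T R) (nu : probability (conf R L) R)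
  (eta : nat -> T -> conf R L) (X : nat -> T -> L) (U : nat -> T -> R).
Hypothesis H : cbtw_process P ab nu eta X U.
Local Notation n := #|{: L}|.
Local Notation unif := (uniform_prob ab).
Local Notation sigma := (cbtw_sigma (eta 0%N) X U).
Local Notation I := (unit + (nat + nat))%type.

Let mX t x : measurable (X t @^-1` [set x]) := cbtw_X_meas H t x.

Let mU t : measurable_fun setT (U t : T -> measurableTypeR R) := cbtw_U_meas H t.

Lemma measurable_eta t : measurable_fun setT (eta t).
Proof.
elim: t => [|t IH]; first exact: cbtw_eta0_meas H.
move=> _ B mB; rewrite setTI.
rewrite (_ : _ @^-1` B = \bigcup_(x : L) (X t @^-1` [set x] `&`
    ((fun w => addition x (U t w) (eta t w)) @^-1` B))).
  apply: countable_bigcup_measurable => x; apply: measurableI; first exact: mX.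
  apply: measurable_preimageT mB.
  have m1 : measurable_fun setT (fun w => (U t w : measurableTypeR R, eta t w)).
    by apply: measurable_fun_pair => //; exact: mU.
  exact: (measurableT_comp (measurable_addition hd x) m1).
apply/seteqP; split=> w /=.
  by rewrite (cbtw_step H) => Bw; exists (X t w).
by move=> [x _ [<-]]; rewrite (cbtw_step H).
Qed.

Lemma measurable_sigma i A : sigma i A -> measurable A.
Proof.
case: i => [[]|[t|t]] [B mB <-]; rewrite setTI.
- exact: measurable_preimageT (cbtw_eta0_meas H) mB.
- rewrite (_ : _ @^-1` B = \bigcup_(x in B) (X t @^-1` [set x])).
    rewrite bigcup_mkcond; apply: countable_bigcup_measurable => x.
    by case: ifP => // _; exact: mX.
  apply/seteqP; split=> w /=; first by exists (X t w).
  by move=> [x Bx /= ->].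
- exact: measurable_preimageT (mU t) mB.
Qed.

Definition future (t : nat) (J : {fset I}) := forall i, i \in J ->
  match i with inl _ => False | inr (inl s) => (t <= s)%N | inr (inr s) => (t <= s)%N end.

Definition upd (E : I -> set T) (i : I) (A : set T) : I -> set T :=
  fun j => if j == i then A else E j.

Lemma bigcap_upd (J : {fset I}) E i A : i \notin J ->
  \bigcap_(j in [set` (i |` J)%fset]) upd E i A j = A `&` \bigcap_(j in [set` J]) E j.
Proof.
move=> iJ; rewrite bigcap_fsetU1 {1}/upd eqxx; congr (_ `&` _).
apply: eq_bigcapr => j /= jJ; rewrite /upd; case: eqP => // ji.
by rewrite -ji jJ in iJ.
Qed.

Lemma prod_upd (J : {fset I}) E i A : i \notin J ->
  \prod_(j <- (i |` J)%fset) P (upd E i A j) = P A * \prod_(j <- J) P (E j).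
Proof.
move=> iJ; rewrite big_fsetU1 //= {1}/upd eqxx; congr (_ * _).
rewrite [LHS]big_seq [RHS]big_seq; apply: eq_bigr => j jJ; rewrite /upd.
by case: eqP => // ji; rewrite -ji jJ in iJ.
Qed.

Lemma sigma_upd (J : {fset I}) E i A : sigma i A ->
  (forall j, j \in J -> sigma j (E j)) ->
  forall j, j \in (i |` J)%fset -> sigma j (upd E i A j).
Proof.
move=> sA sE j; rewrite /upd; case: eqP => [->//|ji].
by rewrite in_fset1U => /predU1P[//|]; exact: sE.
Qed.

Lemma measurable_bigcap_sigma (J : {fset I}) E : (forall j, j \in J -> sigma j (E j)) ->
  measurable (\bigcap_(j in [set` J]) E j).
Proof.
move=> sE; apply: fin_bigcap_measurable; first exact: finite_fset.
by move=> j /= jJ; exact: measurable_sigma (sE j jJ).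
Qed.

Definition law t : probability (conf R L) R :=
  distribution P (HB.pack_for {mfun T >-> conf R L} (eta t)
    (isMeasurableFun.Build _ _ _ _ _ (measurable_eta t))).

Lemma lawE t B : law t B = P (eta t @^-1` B).
Proof. by []. Qed.

(** Carrying an arbitrary finite family of future events makes the induction close: passing to the
    next time only requires adding [X t] and [U t] to the family. *)
Definition independent_of_future t := forall (J : {fset I}) E B,
  future t J -> (forall j, j \in J -> sigma j (E j)) -> measurable B ->
  P (eta t @^-1` B `&` \bigcap_(j in [set` J]) E j) =
  law t B * \prod_(j <- J) P (E j).

Lemma independent_of_future0 : independent_of_future 0.
Proof.
move=> J E B fJ sE mB; rewrite lawE.
have iJ : inl tt \notin J by apply/negP => /fJ.
have sB : sigma (inl tt) (eta 0%N @^-1` B) by exists B => //; rewrite setTI.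
by have := cbtw_indep H (sigma_upd sB sE); rewrite bigcap_upd // prod_upd.
Qed.

(** For rectangles in the pair of input and state, this is the hypothesis at time [t] with events of
    [X t] and [U t] added to the family. The preimage of [B] under an addition is no rectangle,
    hence the appeal to [scaled_product_unique]. *)
Lemma joint_law t : independent_of_future t -> forall (J : {fset I}) E x B,
  future t.+1 J -> (forall j, j \in J -> sigma j (E j)) -> measurable B ->
  P (((fun w => addition x (U t w) (eta t w)) @^-1` B `&`
     \bigcap_(j in [set` J]) E j) `&` X t @^-1` [set x]) =
  \prod_(j <- J) P (E j) * ((n%:R^-1)%:E *
    (unif \x law t) ((fun p => addition x p.1 p.2) @^-1` B)).
Proof.
move=> IH J E x B fJ sE mB.
set G := \bigcap_(j in [set` J]) E j.
have mG : measurable G by exact: measurable_bigcap_sigma.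
have mGX : measurable (G `&` X t @^-1` [set x]) by apply: measurableI.
have mp : measurable_fun setT (fun w => (U t w : measurableTypeR R, eta t w)).
  by apply: measurable_fun_pair; [exact: mU|exact: measurable_eta].
have pG : \prod_(j <- J) P (E j) = P G by rewrite (cbtw_indep H).
have fG : P G \is a fin_num by rewrite fin_num_measure.
pose k : R := (fine (P G) * n%:R^-1)%R.
have k0 : (0 <= k)%R by rewrite mulr_ge0 // ?invr_ge0 // fine_ge0.
pose m : {measure set (measurableTypeR R * conf R L) -> \bar R} :=
  measure_function_pushforward__canonical__measure_function_Measure
    (mrestr P mGX) mp.
have mE C : m C = P ((fun w => (U t w, eta t w)) @^-1` C `&` (G `&` X t @^-1` [set x])).
  by [].
have mrect (A : set (measurableTypeR R)) (C : set (conf R L)) : measurable A -> measurable C ->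
    m (A `*` C) = k%:E * (unif A * law t C).
  move=> mA mC; rewrite mE.
  pose iU : I := inr (inr t); pose iX : I := inr (inl t).
  have iUJ : iU \notin J by apply/negP => /fJ; rewrite /= ltnn.
  have iXJ : iX \notin (iU |` J)%fset.
    by rewrite in_fset1U /=; apply/negP => /fJ; rewrite /= ltnn.
  have sU : sigma iU (U t @^-1` A) by exists A => //; rewrite setTI.
  have sX : sigma iX (X t @^-1` [set x]) by exists [set x] => //; rewrite setTI.
  have fJ' : future t (iX |` (iU |` J))%fset.
    by move=> i; rewrite !in_fset1U => /predU1P[->|/predU1P[->|/fJ]] //;
      case: i => [|[]] //= s /ltnW.
  have := IH _ _ C fJ' (sigma_upd sX (sigma_upd sU sE)) mC.
  rewrite bigcap_upd // bigcap_upd // prod_upd // prod_upd // pG.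
  rewrite (cbtw_X_law H) (cbtw_U_law H) // => e.
  rewrite (_ : _ `&` _ = eta t @^-1` C `&` (X t @^-1` [set x] `&` (U t @^-1` A `&` G))).
    apply: etrans e _; rewrite /k EFinM fineK //.
    rewrite [RHS]muleC -[RHS]muleA [RHS]muleCA; congr (_ * _).
    by rewrite muleCA; congr (_ * _); rewrite muleC.
  apply/seteqP; split=> w /=; first by move=> [[? ?] [? ?]].
  by move=> [? [? [? ?]]].
have mB' : measurable ((fun p : measurableTypeR R * conf R L => addition x p.1 p.2) @^-1` B).
  exact: measurable_preimageT (measurable_addition hd x) mB.
have := scaled_product_unique k0 mrect mB'.
rewrite mE pG muleA /k EFinM fineK // => <-; congr (P _).
by rewrite -setIA.
Qed.

Lemma law_succ t : independent_of_future t -> forall B, measurable B ->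
  law t.+1 B = \sum_(x : L) (n%:R^-1)%:E *
    (unif \x law t) ((fun p => addition x p.1 p.2) @^-1` B).
Proof.
move=> IH B mB; rewrite lawE (measure_partition _ (mX t)); last first.
  exact: measurable_preimageT (measurable_eta _) mB.
apply: eq_bigr => x _.
have := @joint_law t IH fset0 (fun=> setT) x B.
rewrite big_seq_fset0 mul1e => <- //; congr (P _).
rewrite set_fset0 bigcap_set0 setIT; apply/seteqP; split=> w /= [];
  by rewrite (cbtw_step H) => + e; rewrite e.
Qed.

Lemma independent_of_futureP t : independent_of_future t.
Proof.
elim: t => [|t IH]; first exact: independent_of_future0.
move=> J E B fJ sE mB.
have mG := measurable_bigcap_sigma sE.
rewrite (measure_partition _ (mX t)); last first.
  apply: measurableI => //; exact: measurable_preimageT (measurable_eta _) mB.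
rewrite law_succ // muleC ge0_sume_distrr; last first.
  by move=> x _; rewrite mule_ge0 // lee_fin invr_ge0.
apply: eq_bigr => x _; rewrite -joint_law //; congr (P _).
apply/seteqP; split=> w /= [[]];
  by rewrite (cbtw_step H) => + ? e; rewrite e.
Qed.

Lemma integral_law t f : measurable_fun setT f -> (forall xi, 0 <= f xi) ->
  \int[law t]_xi f xi = \int[nu]_xi iter t (transition ab) f xi.
Proof.
elim: t f => [|t IH] f mf f0 /=.
  by apply: eq_measure_integral => B mB _; exact: (cbtw_eta0_law H mB).
rewrite (integral_law_succ hd L0 (pi := law t) (ab := ab)) //.
- rewrite IH -?iterSr //; first exact: measurable_transition.
  exact: transition_ge0.
move=> B mB; have m1 := measurable_indicE mB.
have p1 xi : 0 <= (\1_B xi : R)%:E by rewrite lee_fin.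
rewrite (law_succ (@independent_of_futureP t) mB) integral_transition //.
apply: eq_bigr => x _; congr (_ * _).
have mB' : measurable ((fun p : measurableTypeR R * conf R L => addition x p.1 p.2) @^-1` B).
  exact: measurable_preimageT (measurable_addition hd x) mB.
transitivity (\int[unif \x law t]_p (\1_((fun p : measurableTypeR R * conf R L =>
    addition x p.1 p.2) @^-1` B) p)%:E).
  by rewrite integral_indic // setIT.
by apply: eq_integral => p _; rewrite !indicE; congr (_%:R%:E).
Qed.

End Process.

(** * Exponential convergence *)

(** Bernoulli's inequality, which provides a rate per step without extracting a root. *)
Lemma bernoulli_lower (R : realDomainType) (x : R) (N : nat) :
  0 <= x <= 1 -> 1 - N%:R * x <= (1 - x) ^+ N.
Proof.
move=> /andP[x0 x1]; elim: N => [|N IH]; first by rewrite expr0 mul0r subr0.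
rewrite exprS; apply: le_trans (ler_wpM2l _ IH); last by rewrite subr_ge0.
have : 0 <= N%:R * x * x by rewrite !mulr_ge0.
by rewrite -natr1; nra.
Qed.

Section Convergence.
Local Open Scope ereal_scope.
Context {R : realType} {d : nat} {L : {fset 'rV[int]_d}}.
Hypothesis hd : (0 < d)%N.
Hypothesis L0 : (0 < #|{: L}|)%N.
Variables (a b : R).
Hypothesis ab : (a < b)%R.
Hypothesis ha : (0 <= a)%R.
Local Notation mu := (@allowed_prob R d L).
Local Notation P := (@transition R d L a b ab).

Lemma iter_transition_rate : exists C rho : R, [/\ (0 <= C)%R, (0 < rho < 1)%R &
  forall t (f : conf R L -> \bar R) eta,
    measurable_fun setT f -> (forall xi, 0 <= f xi) ->
    \int[mu]_xi f xi \is a fin_num -> stable eta ->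
    (1 - C * rho ^+ t)%:E * \int[mu]_xi f xi <= iter t P f eta].
Proof.
have [N [e e01 He]] := doeblin hd L0 ab ha.
have /andP[e0 e1] := e01; set M := N.+1.
have M0 : (0 < M%:R :> R)%R by rewrite ltr0n.
have eM : (e / M%:R <= e)%R by rewrite ler_pdivrMr // ler_peMr ?ler1n // ltW.
(* A stand-in for the [M]-th root of [1 - e]: its [M]-th power is at least [1 - e]. *)
pose rho := (1 - e / M%:R)%R.
have rho0 : (0 < rho)%R by rewrite subr_gt0 (le_lt_trans eM).
have rho1 : (rho < 1)%R by rewrite gtrBl divr_gt0.
(* The prefactor pays for the fewer than [M] steps left after the last complete round; these steps
   are applied to [f] first, which leaves its [mu]-mean unchanged. *)
exists (rho ^- M)%R, rho; split; [by rewrite invr_ge0 exprn_ge0 ?ltW|by rewrite rho0|].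
move=> t f eta mf f0 fin se.
have int_iter := integral_iter_transition hd (t %% M)
  (fun h mh h0 => integral_allowed_prob_transition hd L0 ab ha mh h0) mf f0.
rewrite {2}(divn_eq t M) iterD -int_iter.
have mi := measurable_iter_transition hd ab (t %% M) mf f0.
have i0 := iter_transition_ge0 ab (t %% M) f0.
have fini : \int[mu]_xi iter (t %% M) P f xi \is a fin_num by rewrite int_iter.
have := iter_transition_lower hd L0 ha e01 He (t %/ M) mi i0 fini se.
apply: le_trans; apply: lee_wpmul2r; first exact: integral_ge0.
rewrite lee_fin lerD2l lerN2.
have eb : (1 - e <= rho ^+ M)%R.
  have -> : (1 - e = 1 - M%:R * (e / M%:R))%R by rewrite mulrC divfK // gt_eqF.
  apply: bernoulli_lower.
  by rewrite divr_ge0 ?(ltW e0) ?(ltW M0) //= (le_trans eM) // ltW.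
apply: (@le_trans _ _ (rho ^+ (t %/ M * M))%R).
  rewrite mulnC exprM lerXn2r // ?nnegrE ?subr_ge0 ?(ltW e1) //.
  by rewrite exprn_ge0 // ltW.
rewrite mulrC ler_pdivlMr ?exprn_gt0 // -exprD ler_wiXn2l ?(ltW rho0) ?(ltW rho1) //.
by rewrite {1}(divn_eq t M) leq_add2l ltnW // ltn_pmod.
Qed.

(** The bound for [B] gives [p B] at least [q B - r]; the bound for the complement gives the
    opposite estimate. *)
Lemma prob_dist_le (p q : probability (conf R L) R) (r : R) : (0 <= r)%R ->
  (forall B, measurable B -> (1 - r)%:E * q B <= p B) ->
  forall B, measurable B -> `|p B - q B| <= r%:E.
Proof.
move=> r0 le B mB.
have h1 := le _ mB; have h2 := le _ (measurableC mB).
rewrite !probability_setC // in h2.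
have y1 := probability_le1 q mB.
have y0 : 0 <= q B by [].
move: (fin_num_measure p _ mB) (fin_num_measure q _ mB) h1 h2 y0 y1.
move: (p B) (q B) => [x| |] [y| |] // _ _.
rewrite -!EFinB -!EFinM abse_EFin !lee_fin => h1 h2 y0 y1.
by rewrite ler_norml; apply/andP; split; nra.
Qed.

Lemma eq_geometric_dist (x y : \bar R) (C rho : R) : (0 <= C)%R -> (0 < rho < 1)%R ->
  x \is a fin_num -> y \is a fin_num ->
  (forall t, `|x - y| <= (C * rho ^+ t)%:E) -> x = y.
Proof.
move=> C0 /andP[r0 r1]; case: x => [x| |] //; case: y => [y| |] // _ _ dist.
congr (_%:E); apply/eqP; rewrite -subr_eq0 -normr_le0 leNgt; apply/negP => gap.
have : (C * rho ^+ t)%R @[t --> \oo] --> (C * 0)%R.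
  by apply: cvgMr; apply: cvg_expr; rewrite gtr0_norm.
rewrite mulr0 => /cvgrPdist_lt/(_ _ gap)[N _ /(_ N (leqnn N))].
rewrite sub0r normrN ger0_norm ?mulr_ge0 ?exprn_ge0 ?(ltW r0) //.
by rewrite ltNge => /negP; apply; rewrite -lee_fin; exact: dist.
Qed.

Lemma integral_iter_lower C rho : (0 < rho)%R ->
  (forall t (f : conf R L -> \bar R) eta,
    measurable_fun setT f -> (forall xi, 0 <= f xi) ->
    \int[mu]_xi f xi \is a fin_num -> stable eta ->
    (1 - C * rho ^+ t)%:E * \int[mu]_xi f xi <= iter t P f eta) ->
  forall (pi : probability (conf R L) R) t B, pi stable = 1 -> measurable B ->
  (1 - C * rho ^+ t)%:E * mu B <= \int[pi]_xi iter t P (fun xi => (\1_B xi)%:E) xi.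
Proof.
move=> rho0 rate pi t B ps mB.
have m1 := measurable_indicE mB.
have p1 xi : 0 <= (\1_B xi : R)%:E by rewrite lee_fin.
have mi := measurable_iter_transition hd ab t m1 p1.
have i0 := iter_transition_ge0 ab t p1.
have E : \int[mu]_xi (\1_B xi)%:E = mu B by rewrite integral_indic // setIT.
(* At small times the factor may be negative and the bound is trivial; otherwise the constant can be
   integrated as a nonnegative function. *)
have [neg|pos] := leP (1 - C * rho ^+ t)%R 0%R.
  apply: le_trans (integral_ge0 _ _) => //.
  by apply: mule_le0_ge0 => //; rewrite lee_fin.
rewrite -(integral_prob1 (@measurable_stable R d L) ps mi i0).
have -> : (1 - C * rho ^+ t)%:E * mu B =
    \int[pi]_(xi in stable) cst ((1 - C * rho ^+ t)%:E * mu B) xi.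
  by rewrite (integral_cst _ (@measurable_stable R d L)) /= ps mule1.
have mst := @measurable_stable R d L.
apply: ge0_le_integral => //.
- by move=> xi _; rewrite mule_ge0 // lee_fin ltW.
- exact: measurable_funTS.
- move=> xi sxi; rewrite /cst -E; apply: (rate t _ xi m1 p1 _ sxi).
  by apply: (eq_ind_r (fun z => z \is a fin_num) _ E); exact: fin_num_measure.
Qed.

End Convergence.

Theorem theorem2p3 (R : realType) (d : nat) (hd : (0 < d)%N)
    (L : {fset 'rV[int]_d}) (hL : L != fset0)
    (a b : R) (ha : 0 <= a) (ab : a < b) (hb : b < 1) :
  exists mu : probability (conf R L) R,
    [/\ forall B, measurable B -> mu B = mu_allowed B,
        mu stable = 1%E /\ cbtw_invariant ab mu,
        forall pi : probability (conf R L) R,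
          pi stable = 1%E -> cbtw_invariant ab pi ->
          forall B, measurable B -> pi B = mu B
      & forall nu : probability (conf R L) R, nu stable = 1%E ->
          exists C rho : R, 0 < rho < 1 /\
          forall (disp : measure_display) (T : measurableType disp)
              (P : probability T R) (eta : nat -> T -> conf R L)
              (X : nat -> T -> L) (U : nat -> T -> R),
            cbtw_process P ab nu eta X U ->
            forall t, (total_variation_dist (pushforward P (eta t)) mu
                       <= (C * rho ^+ t)%:E)%E].
Proof.
have L0 : (0 < #|{: L}|)%N by rewrite -cardfE cardfs_gt0.
have [C [rho [C0 rho01 rate]]] := iter_transition_rate hd L0 ab ha.
have /andP[rho0 rho1] := rho01.
have Cr0 t : 0 <= C * rho ^+ t by rewrite mulr_ge0 // exprn_ge0 // ltW.
have lower := integral_iter_lower hd rho0 rate.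
exists (@allowed_prob R d L); split.
- by move=> B _; exact: allowed_prob_mu_allowed.
- split; first exact: allowed_prob_stable.
  exact: allowed_prob_invariant.
- move=> pi ps pinv B mB.
  (* Started from [pi] the law is [pi] at every time, so its distance to the limit is below every
     term of a geometric sequence. *)
  have dist t : (`|pi B - allowed_prob B| <= (C * rho ^+ t)%:E)%E.
    apply: prob_dist_le => // B' mB'; apply: le_trans (lower pi t B' ps mB') _.
    rewrite (integral_iter_transition hd t
      (fun h mh h0 => invariant_integral hd L0 ps pinv mh h0)).
    + by rewrite integral_indic // setIT.
    + exact: measurable_indicE.
    + by move=> xi; rewrite lee_fin.
  apply: (eq_geometric_dist C0 rho01 _ _ dist); exact: fin_num_measure.
(* The same two constants serve every initial law. *)
- move=> nu nus; exists C, rho; split=> // disp T P eta X U H t.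
  apply: ge_ereal_sup => _ [B mB <-].
  apply: (prob_dist_le (p := law hd H t)) => // B' mB'.
  apply: le_trans (lower nu t B' nus mB') _.
  rewrite -(integral_law hd L0 H).
  + by rewrite integral_indic // setIT.
  + exact: measurable_indicE.
  + by move=> xi; rewrite lee_fin.
Qed.
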